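(* With the vertex set of the twisted quiver identified with $\overline I^{\mathrm{tw},\flat}_\xi$, there exists a $\mathbb Z$-algebra isomorphism $\widetilde\Phi^T\colon\mathcal T_{\mathcal Q^\flat}\to\mathcal Y_{t,\mathcal Q^\flat}$ given by \[ v^{\pm1/2}\mapsto t^{\mp1/2},\qquad X_{(i,r)}\mapsto\underline{m^{(i)}_{k(i,r),r}}=\underline{\prod_{s=1}^{k(i,r)}Y_{i,r+2r_i(s-1)}} \] for $(i,r)\in\overline I^{\mathrm{tw},\flat}_\xi$. Moreover $\widetilde\Phi^T\circ\overline{(\cdot)}=\overline{(\cdot)}\circ\widetilde\Phi^T$. Here, on $\mathcal T_{\mathcal Q^\flat}$, the map $\overline{(\cdot)}$ is the $\mathbb Z$-linear anti-involution $v^{r/2}X^{\bm c}\mapsto v^{-r/2}X^{\bm c}$.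
   Context: Type $\mathrm B_n$ data. Fix $n\ge2$; $I=\{1,\dots,n\}$, type $\mathrm B_n$ with $\alpha_n$ short. The Cartan matrix $c_{ij}=\langle h_i,\alpha_j\rangle$ has $c_{ii}=2$, $c_{i,i\pm1}=-1$ except $c_{n,n-1}=-2$, and $0$ otherwise; $r_i=2$ for $i<n$ and $r_n=1$. $\mathcal Y=\mathbb Z[Y_{i,r}^{\pm1}\mid i\in I,r\in\mathbb Z]$. Quantum torus. Let $C(z)$ be the matrix with $C(z)_{ii}=z^{r_i}+z^{-r_i}$ and $C(z)_{ij}=(z^{c_{ij}}-z^{-c_{ij}})/(z-z^{-1})$ for $i\neq j$, and expand $C(z)^{-1}_{ji}=\sum_r\tilde c_{ji}(r)z^r$ in $\mathbb Z((z^{-1}))$. $\mathcal Y_t$ is the $\mathbb Z$-algebra generated by central $t^{\pm1/2}$ and invertible $\widetilde Y_{i,r}$ with $\widetilde Y_{i,r}\widetilde Y_{j,s}=t^{\gamma(i,r;j,s)}\widetilde Y_{j,s}\widetilde Y_{i,r}$, where \[ \gamma(i,r;j,s)=\tilde c_{ji}(-r_j-r+s)+\tilde c_{ji}(r_j+r-s)-\tilde c_{ji}(r_j-r+s)-\tilde c_{ji}(-r_j+r-s). \] The bar anti-involution of $\mathcal Y_t$ is $t^{1/2}\mapsto t^{-1/2}$, $\widetilde Y_{i,r}\mapsto t^{-1}\widetilde Y_{i,r}$. For a monomial $m$ in $\mathcal Y$, $\underline m$ is the unique bar-invariant element $t^{a/2}\widetilde Y_{i_1,r_1}^{\pm1}\cdots\widetilde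 Y_{i_k,r_k}^{\pm1}$ specializing (via $t^{1/2}\mapsto1$, $\widetilde Y\mapsto Y$) to $m$. Twisted set. Let $\mathcal Q$ be a quiver of type $\mathrm A_{2n-2}$ (vertices $1,\dots,2n-2$), and $\xi$ a height function: $\xi(j)=\xi(i)+1$ for each arrow $i\to j$. Let $\widehat I_\xi=\{(i,p):1\le i\le2n-2,\ p\equiv\xi(i)\ (\mathrm{mod}\ 2),\ \xi(2n-1-i)-(2n-1)<p\le\xi(i)\}$, and fix $\flat\in\{>,<\}$. $\widehat I^{\mathrm{tw},\flat}_\xi\subset\{1,\dots,2n-1\}\times\frac12\mathbb Z$ is the union of: - $(i,p)$ for $(i,p)\in\widehat I_\xi$ with $i\le n-1$; - $(i+1,p)$ for $(i,p)\in\widehat I_\xi$ with $i\ge n$; - $(n,p-\frac12)$ whenever $\{(n-1,p-1),(n,p)\}\subset\widehat I_\xi$ or $\{(n,p-1),(n-1,p)\}\subset\widehat I_\xi$; - $(n,r_M+\frac12)$ if $\flat={>}$, or $(n,r_m-\frac12)$ if $\flat={<}$, where $r_M$ ($r_m$) is the max (min) of $\{p:(n-1,p)\in\widehat I_\xi\text{ or }(n,p)\in\widehat I_\xi\}$. $\overline I^{\mathrm{tw},\flat}_\xi$ is the image of $\widehat I^{\mathrm{tw},\flat}_\xi$ under the injective map $(\imath,s)\mapsto(\imath,2s)$ ($\imath\le n$), $(\imath,s)\mapsto(2n-\imath,2s)$ ($\imath>n$). For $(i,r)\in\overline I^{\mathrm{tw},\flat}_\xi$ put $k(i,r)=\#\{r'\in\mathbb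 Z:(i,r')\in\overline I^{\mathrm{tw},\flat}_\xi,\ r'-r\in2r_i\mathbb Z_{\ge0}\}$. $\mathcal Y_{t,\mathcal Q^\flat}$ is the $\mathbb Z[t^{\pm1/2}]$-subalgebra of $\mathcal Y_t$ generated by $\widetilde Y_{i,r}^{\pm1}$, $(i,r)\in\overline I^{\mathrm{tw},\flat}_\xi$. Quantum torus $\mathcal T_{\mathcal Q^\flat}$. List the first coordinates of the elements of $\widehat I^{\mathrm{tw},\flat}_\xi$ in order of decreasing second coordinate; elements with equal second coordinate have non-adjacent first coordinates and are listed in any order. This gives a reduced word $(\imath_1,\dots,\imath_\ell)$, $\ell=n(2n-1)$, of the longest element of the Weyl group of type $\mathrm A_{2n-1}$. The $k$-th position is identified with the corresponding element of $\overline I^{\mathrm{tw},\flat}_\xi$. Let $w_{\le k}=s_{\imath_1}\cdots s_{\imath_k}$, $\varpi_\imath$ the fundamental weights of $\mathrm A_{2n-1}$ and $(\cdot,\cdot)$ the invariant form with $(\alpha,\alpha)=2$. Let $\Lambda$ be the skew-symmetric integer matrix with \[ \lambda_{st}=(\varpi_{\imath_s}-w_{\le s}\varpi_{\imath_s},\varpi_{\imath_t}+w_{\le t}\varpi_{\imath_t})\quad(s<t). \] $\mathcal T_{\mathcal Q^\flat}$ is the free $\mathbb Z[v^{\pm1/2}]$-module with basis $\{X^{\bm a}\mid\bm a\in\mathbb Z^{\ell}\}$ and product $X^{\bm a}X^{\bm b}=v^{\Lambda(\bm a,\bm b)/2}X^{\bm a+\bm b}$. $X_{(i,r)}$ denotes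 $X^{\bm e_k}$ for the position $k$ corresponding to $(i,r)$. *)

(* Defs.v *)
From HB Require Import structures.
From mathcomp Require Import all_boot all_order all_algebra.
From mathcomp Require Import finmap monalg.
From Stdlib Require Import ClassicalEpsilon.

Set Implicit Arguments.
Unset Strict Implicit.
Unset Printing Implicit Defensive.

Import Order.TTheory GRing.Theory Num.Theory.
Local Open Scope ring_scope.

(* Quantum tori.  An element of a quantum torus with lattice K over    *)
(* Z[q^{+-1/2}] is a finitely supported Z-valued function on int * K;   *)
(* the key (k, u) stands for the basis element  q^{k/2} X^u.           *)
(* The product is  q^{k/2}X^u * q^{l/2}X^w = q^{(k+l+B u w)/2} X^{u+w}. *)
Definition qtorus (K : zmodType) := {malg int[(int * K)%type]}.

Section QTorus.
Variable K : zmodType.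
Variable B : K -> K -> int.

Definition qmono (k : int) (u : K) : qtorus K := << (k, u) >>.

Definition qone : qtorus K := qmono 0 0.

Definition qmul (x y : qtorus K) : qtorus K :=
  \sum_(p <- enum_fset (msupp x)) \sum_(p' <- enum_fset (msupp y))
     << x@_p * y@_p' *g (p.1 + p'.1 + B p.2 p'.2, p.2 + p'.2) >>.

Definition qbar (x : qtorus K) : qtorus K :=
  \sum_(p <- enum_fset (msupp x)) << x@_p *g (- p.1, p.2) >>.
End QTorus.

Definition cartanB (n i j : nat) : int :=
  if ~~ ((1 <= i <= n)%N && (1 <= j <= n)%N) then 0
  else if i == j then 2
  else if (i == n) && (j == n.-1) then -2
  else if (i.+1 == j) || (j.+1 == i) then -1
  else 0.

Definition rB (n i : nat) : int := if (i < n)%N then 2 else 1.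

(* coefficient of z^p in (z^c - z^-c)/(z - z^-1) *)
Definition qint_coef (c p : int) : int :=
  Num.sg c * ((`|p| <= `|c| - 1) && ((`|c| - 1 - `|p|) %% 2 == 0)%Z)%:R.

(* coefficient of z^p in C(z)_{jk} *)
Definition Ccoef (n j k : nat) (p : int) : int :=
  if j == k then ((p == rB n j)%:R + (p == - rB n j)%:R)
  else qint_coef (cartanB n j k) p.

(* c : j -> i -> r -> ctilde_{ji}(r) is the coefficient family of the  *)
(* inverse C(z)^{-1} expanded in Z((z^{-1})) (supports bounded above), *)
(* characterised by C(z) C(z)^{-1} = 1.                                *)
Definition is_Cinv (n : nat) (c : nat -> nat -> int -> int) : Prop :=
  (forall j i r, ~~ ((1 <= j <= n)%N && (1 <= i <= n)%N) -> c j i r = 0) /\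
  (forall j i, exists N : int, forall r : int, N < r -> c j i r = 0) /\
  (forall j i (r : int), (1 <= j <= n)%N -> (1 <= i <= n)%N ->
     \sum_(1 <= k < n.+1) \sum_(p <- [:: -2; -1; 0; 1; 2])
        Ccoef n j k p * c k i (r - p) = ((j == i) && (r == 0))%:R).

Definition ctilde (n : nat) : nat -> nat -> int -> int :=
  epsilon (inhabits (fun _ _ _ => 0)) (is_Cinv n).

Definition gammaB (n : nat) (a b : nat * int) : int :=
  let: (i, r) := a in let: (j, s) := b in
  let c := ctilde n j i in
  c (- rB n j - r + s) + c (rB n j + r - s)
  - c (rB n j - r + s) - c (- rB n j + r - s).

(* lattice of monomials Y^u in the Y_{i,r}'s *)
Definition Yexp := {malg int[(nat * int)%type]}.

Definition BY (n : nat) (u w : Yexp) : int :=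
  \sum_(a <- enum_fset (msupp u)) \sum_(b <- enum_fset (msupp w)) u@_a * w@_b * gammaB n a b.

(* The quantum torus Y_t (q = t):  basis t^{k/2} \underline{Y^u}. *)
Definition Yt (n : nat) := qtorus Yexp.
Definition Ymul (n : nat) := qmul (BY n).
Definition Ybar (n : nat) : Yt n -> Yt n := @qbar Yexp.

Definition underline (n : nat) (u : Yexp) : Yt n := qmono 0 u.

(* generators  \widetilde Y_{i,r} = t^{1/2} \underline{Y_{i,r}}      *)
(* (the bar-invariant element is t^{-1/2} \widetilde Y_{i,r}).        *)
Definition tildeY (n : nat) (a : nat * int) : Yt n := qmono 1 << a >>.

Unset Implicit Arguments.
Inductive in_gen_subalg (n : nat) (S : seq (nat * int)) : Yt n -> Prop :=
| gsa_tpow k : in_gen_subalg n S (qmono k 0)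
| gsa_0 : in_gen_subalg n S 0
| gsa_gen a : a \in S -> in_gen_subalg n S (tildeY n a)
| gsa_inv a y : a \in S -> Ymul n (tildeY n a) y = qone _ ->
    Ymul n y (tildeY n a) = qone _ -> in_gen_subalg n S y
| gsa_opp x : in_gen_subalg n S x -> in_gen_subalg n S (- x)
| gsa_add x y : in_gen_subalg n S x -> in_gen_subalg n S y ->
    in_gen_subalg n S (x + y)
| gsa_mul x y : in_gen_subalg n S x -> in_gen_subalg n S y ->
    in_gen_subalg n S (Ymul n x y).
Set Implicit Arguments.

Definition mexp (n i k : nat) (r : int) : Yexp :=
  \sum_(1 <= s < k.+1) << (i, r + 2 * rB n i * (s.-1)%:Z) >>.

(* The twisted set.  Second coordinates in (1/2)Z are stored doubled. *)
Definition irange (lo hi : int) : seq int :=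
  if lo < hi then [seq lo + (k.+1)%:Z | k <- iota 0 `|hi - lo|] else [::].

(* \widehat I_xi for a quiver of type A_{2n-2} with height function xi *)
Definition Ihat (n : nat) (xi : nat -> int) : seq (nat * int) :=
  [seq (i, p) | i <- iota 1 (2 * n - 2),
     p <- [seq p <- irange (xi (2 * n - 1 - i)%N - (2 * n - 1)%:Z) (xi i)
           | ((p - xi i) %% 2)%Z == 0]].

Definition Pnlist (n : nat) (xi : nat -> int) : seq int :=
  [seq x.2 | x <- Ihat n xi & (x.1 == n.-1) || (x.1 == n)].
Definition r_max n xi := foldr Num.max (head 0 (Pnlist n xi)) (Pnlist n xi).
Definition r_min n xi := foldr Num.min (head 0 (Pnlist n xi)) (Pnlist n xi).

(* membership in \widehat I^{tw,flat}_xi, element (iota, q/2);          *)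
(* flat = true means  flat = '>'                                         *)
Definition in_twisted (n : nat) (xi : nat -> int) (flat : bool)
    (x : nat * int) : bool :=
  let: (j, q) := x in
  let Ih := Ihat n xi in
  [|| (1 <= j <= n.-1)%N && ((q %% 2)%Z == 0) && ((j, (q %/ 2)%Z) \in Ih),
      (n.+1 <= j)%N && ((q %% 2)%Z == 0) && ((j.-1, (q %/ 2)%Z) \in Ih),
      (j == n) && ((q %% 2)%Z == 1) &&
        (let p := ((q + 1) %/ 2)%Z in
         ((n.-1, p - 1) \in Ih) && ((n, p) \in Ih)
         || ((n, p - 1) \in Ih) && ((n.-1, p) \in Ih))
    | (j == n) &&
      (if flat then q == 2 * r_max n xi + 1 else q == 2 * r_min n xi - 1)].

(* (iota, s) |-> (iota, 2s) or (2n - iota, 2s) *)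
Definition ovl (n : nat) (x : nat * int) : nat * int :=
  if (x.1 <= n)%N then x else ((2 * n - x.1)%N, x.2).

Definition kIr (n : nat) (Ibar : seq (nat * int)) (i : nat) (r : int) : nat :=
  count (fun y : nat * int => (y.1 == i) && (r <= y.2) &&
                    (((y.2 - r) %% (2 * rB n i))%Z == 0)) Ibar.

(* Weights of A_{2n-1} realised in Z^{2n} (coordinates 1..2n).        *)
Definition wvec := nat -> int.
Definition fundw (i : nat) : wvec := fun j => ((1 <= j <= i)%N)%:R.
Definition sref (i : nat) (v : wvec) : wvec :=
  fun j => v (if j == i then i.+1 else if j == i.+1 then i else j).
Definition wact (word : seq nat) (v : wvec) : wvec := foldr sref v word.
Definition wform (n : nat) (v u : wvec) : int :=
  \sum_(1 <= j < (2 * n).+1) v j * u j.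

Definition lam (n : nat) (word : seq nat) (s t : nat) : int :=
  let i_s := nth 0%N word s in let i_t := nth 0%N word t in
  wform n (fun j => fundw i_s j - wact (take s.+1 word) (fundw i_s) j)
          (fun j => fundw i_t j + wact (take t.+1 word) (fundw i_t) j).

Definition Lam (n : nat) (word : seq nat) (s t : nat) : int :=
  if (s < t)%N then lam n word s t
  else if (t < s)%N then - lam n word t s else 0.

(* the quantum torus T_{Q^flat} (q = v) with basis v^{k/2} X^a *)
Definition BT (n : nat) (word : seq nat) :
    'rV[int]_(size word) -> 'rV[int]_(size word) -> int :=
  fun a b => \sum_(s < size word) \sum_(t < size word)
               a 0 s * Lam n word s t * b 0 t.
Arguments BT n word : clear implicits.
Arguments Ymul n : clear implicits.
Arguments Ybar n : clear implicits.
Arguments underline n : clear implicits.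
Arguments tildeY n : clear implicits.
Arguments Yt n : clear implicits.

(* Main.v *)
(* Writing [m_k] as the sum of the [Y_c] over the earlier positions [c] of the same row,
   both sides of [BY m_k m_l = - Lambda_kl] become double sums, and the equality follows
   termwise from [gammaB (Y_c, Y_d) = (beta_c, beta_d)] for [c] before [d], where
   [beta_c = w_{<c} alpha_c]: the fundamental weights telescope along a row.

   The left side is known from a closed form of the inverse quantum Cartan matrix: after
   conjugation by [diag (z^{r_j} - z^{-r_j})] it is the restriction to [z^0, z^{-1}, ...]
   of a family [PB] that is antiperiodic of antiperiod [2 (2 n - 1)].

   For the right side, draw the word as a wiring diagram. Deleting one wire, the one
   involved in all the crossings of row [n], leaves the straight diagram of type A_{2n-2},
   in which the two wires through a crossing are read off its coordinates, modulo
   [4 (2 n - 1)] in doubled coordinates. Hence [beta_c] is the difference of two basis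
   vectors with explicit labels, and [(beta_c, beta_d)] is [PB] as well. *)

Require Import Defs.
From HB Require Import structures.
From mathcomp Require Import all_boot all_order all_algebra.
From mathcomp Require Import finmap monalg.
From mathcomp Require Import zify ring.
From Stdlib Require Import ClassicalEpsilon.
Import Order.TTheory GRing.Theory Num.Theory.
Local Open Scope ring_scope.

(** * Quantum tori *)

(** The number [h = 2 n - 1], the Coxeter number of type A_{2n-2} and the dual Coxeter number of
    type B_n, enters both sides through a reflection at the end of a strip. The conjugated Cartan
    equations have wave solutions [f (x - 2 j) - f (x + 2 j)], which vanish at [j = 0]; the last two
    rows hold because [f] changes sign under [2 h]. In the diagram, a label stays constant along its
    wire until the wire turns back at the last position, where it drops by [4 h]. Labels are all
    congruent modulo 4 while [2 h] is 2 modulo 4, so on their differences the antiperiodic function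
    only tests equality. The word is any decreasing listing, ties in any order, so its letters have
    no formula. The induction follows instead the coordinates at which each row is crossed next; at
    a crossing, congruences and a narrow window determine those of the neighbouring rows. Since
    [ctilde] is a choice among solutions of the defining equation, the closed form needs existence
    and uniqueness of solutions bounded above. Bijectivity is triangularity: [m_k] is the generator
    at [k] times earlier ones. *)

Section LinearExtension.
Context {K : choiceType} {V : zmodType}.

Definition lext (h : K -> V) (x : {malg int[K]}) : V :=
  \sum_(k <- enum_fset (msupp x)) h k *~ x@_k.

Lemma lextEw (h : K -> V) (x : {malg int[K]}) (D : {fset K}) :
  (msupp x `<=` D)%fset -> lext h x = \sum_(k <- enum_fset D) h k *~ x@_k.
Proof.
move=> sxD; apply: (big_fset_incl _ sxD) => k _ kx.
by rewrite mcoeff_outdom ?mulr0z.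
Qed.

Lemma lext_is_additive h : zmod_morphism (lext h).
Proof.
move=> x y; set D := (msupp x `|` msupp y)%fset.
rewrite (lextEw h (x - y) D) ?msuppB_le // (lextEw h x D) ?fsubsetUl //.
rewrite (lextEw h y D) ?fsubsetUr // -sumrB; apply: eq_bigr => k _.
by rewrite mcoeffB mulrzBr.
Qed.

HB.instance Definition _ h :=
  GRing.isZmodMorphism.Build {malg int[K]} V (lext h) (lext_is_additive h).

Lemma lextU h (c : int) k : lext h << c *g k >> = h k *~ c.
Proof.
rewrite (lextEw h << c *g k >> [fset k]%fset) ?msuppU_le //.
by rewrite big_seq_fset1 mcoeffUU.
Qed.

Lemma eq_lext h h' : h =1 h' -> lext h =1 lext h'.
Proof. by move=> e x; apply: eq_bigr => k _; rewrite e. Qed.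

Lemma lextDf h h' x : lext (fun k => h k + h' k) x = lext h x + lext h' x.
Proof. by rewrite -big_split; apply: eq_bigr => k _; rewrite mulrzDl. Qed.

Lemma lextNf h x : lext (fun k => - h k) x = - lext h x.
Proof. by rewrite -sumrN; apply: eq_bigr => k _; rewrite mulNrz. Qed.

Lemma malgU_mulz (c : int) (k : K) : << c *g k >> = << k >> *~ c.
Proof. by rewrite -raddfMz intz. Qed.

Lemma raddf_lext (f : {additive {malg int[K]} -> V}) x :
  f x = lext (fun k => f << k >>) x.
Proof.
rewrite {1}[x]monalgE raddf_sum; apply: eq_bigr => k _.
by rewrite malgU_mulz raddfMz.
Qed.
End LinearExtension.

Lemma lext_comp (K : choiceType) (V W : zmodType) (f : {additive V -> W})
  (h : K -> V) x : f (lext h x) = lext (f \o h) x.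
Proof. by rewrite raddf_sum; apply: eq_bigr => k _; rewrite raddfMz. Qed.

Section KeyMap.
Context {K L : choiceType}.

(** Left multiplication by a monomial, the bar involution and the isomorphism all send basis
    elements to basis elements; as key maps, their identities can be checked on exponents. *)
Definition kmap (g : K -> L) (x : {malg int[K]}) : {malg int[L]} :=
  lext (fun k => << g k >>) x.

HB.instance Definition _ g :=
  GRing.isZmodMorphism.Build {malg int[K]} {malg int[L]} (kmap g)
    (lext_is_additive _).

Lemma kmapE g (x : {malg int[K]}) :
  kmap g x = \sum_(k <- enum_fset (msupp x)) << x@_k *g g k >>.
Proof. by apply: eq_bigr => k _; rewrite -malgU_mulz. Qed.

Lemma kmapU g k : kmap g << k >> = << g k >>.
Proof. by rewrite /kmap lextU mulr1z. Qed.

Lemma lext_kmap (V : zmodType) (h : L -> V) g x :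
  lext h (kmap g x) = lext (h \o g) x.
Proof.
by rewrite lext_comp; apply: eq_lext => k /=; rewrite lextU mulr1z.
Qed.

Lemma mcoeff_kmap g x k : injective g -> (kmap g x)@_(g k) = x@_k.
Proof.
move=> g_inj; rewrite lext_comp (raddf_lext (mcoeff k)).
apply: eq_lext => j /=; rewrite !mcoeffU.
by rewrite (inj_eq g_inj).
Qed.

Lemma kmap_inj g : injective g -> injective (kmap g).
Proof.
move=> g_inj x y exy; apply/malgP => k.
by rewrite -(mcoeff_kmap g x k g_inj) exy mcoeff_kmap.
Qed.
End KeyMap.

Lemma kmap_kmap (K L M : choiceType) (g : K -> L) (g' : L -> M) x :
  kmap g' (kmap g x) = kmap (g' \o g) x.
Proof. exact: lext_kmap. Qed.

Lemma eq_kmap (K L : choiceType) (g g' : K -> L) :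
  g =1 g' -> kmap g =1 kmap g'.
Proof. by move=> e; apply: eq_lext => k; rewrite e. Qed.

Section QuantumTorus.
Variables (K : zmodType) (B : K -> K -> int).

Definition kmul (p p' : int * K) : int * K :=
  (p.1 + p'.1 + B p.2 p'.2, p.2 + p'.2).

Lemma qmulE x y : qmul B x y = lext (fun p => kmap (kmul p) y) x.
Proof.
apply: eq_bigr => p _; rewrite kmapE mulrz_suml; apply: eq_bigr => p' _.
by rewrite malgU_mulz [in RHS]malgU_mulz -mulrzA mulrC.
Qed.

Lemma qmul_monol k u y : qmul B (qmono k u) y = kmap (kmul (k, u)) y.
Proof. by rewrite qmulE lextU mulr1z. Qed.

Lemma qmul_mono k u l v :
  qmul B (qmono k u) (qmono l v) = qmono (k + l + B u v) (u + v).
Proof. by rewrite qmul_monol kmapU. Qed.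

Lemma qmul_mono_inj k u : injective (qmul B (qmono k u)).
Proof.
move=> x y; rewrite !qmul_monol; apply: kmap_inj => -[a b] [c d] [+ /addrI e].
by rewrite e => /addIr /addrI ->.
Qed.

Lemma qbarE x : qbar x = kmap (fun p : int * K => (- p.1, p.2)) x.
Proof. by rewrite kmapE. Qed.
End QuantumTorus.

(** * The map of tori induced by a form-reversing map of lattices *)

Section TorusMorphism.
Variables (K L : zmodType) (B : K -> K -> int) (C : L -> L -> int).
Variable phi : {additive K -> L}.
Hypothesis phiB : forall u v, C (phi u) (phi v) = - B u v.

(** The central exponent is negated because [v] goes to the inverse of [t]; the sign in [phiB]
    compensates for it. *)
Definition tmap : qtorus K -> qtorus L :=
  kmap (fun p : int * K => (- p.1, phi p.2)).

Lemma tmap_mono k u : tmap (qmono k u) = qmono (- k) (phi u).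
Proof. exact: kmapU. Qed.

Lemma tmap_mul x y : tmap (qmul B x y) = qmul C (tmap x) (tmap y).
Proof.
rewrite !qmulE lext_kmap /tmap lext_comp; apply: eq_lext => p /=.
rewrite !kmap_kmap; apply: eq_kmap => p' /=.
rewrite /kmul /= phiB; congr (_, _); [ring|exact: raddfD].
Qed.

Lemma tmap_bar x : tmap (qbar x) = qbar (tmap x).
Proof. by rewrite !qbarE /tmap !kmap_kmap; apply: eq_kmap. Qed.

Lemma tmap_inj : injective phi -> injective tmap.
Proof.
move=> phi_inj; apply: kmap_inj => -[a u] [b v] /= [+ /phi_inj ->].
by move=> /oppr_inj ->.
Qed.
End TorusMorphism.

(** * Bilinearity of the commutation form *)

Section BYTheory.
Variable n : nat.

Lemma BYE u v : BY n u v = lext (fun a => lext (gammaB n a) v) u.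
Proof.
apply: eq_bigr => a _; rewrite mulrz_suml; apply: eq_bigr => b _.
by rewrite -mulrzA -mulrzr intz mulrC [v@_b * _]mulrC.
Qed.

Lemma BYDl u u' v : BY n (u + u') v = BY n u v + BY n u' v.
Proof. by rewrite !BYE raddfD. Qed.

Lemma BYDr u v v' : BY n u (v + v') = BY n u v + BY n u v'.
Proof.
by rewrite !BYE -lextDf; apply: eq_lext => a; rewrite raddfD.
Qed.

Lemma BYU a b : BY n << a >> << b >> = gammaB n a b.
Proof. by rewrite BYE !lextU. Qed.

Lemma BYNl u v : BY n (- u) v = - BY n u v.
Proof. by rewrite !BYE raddfN. Qed.

Lemma BYNr u v : BY n u (- v) = - BY n u v.
Proof. by rewrite !BYE -lextNf; apply: eq_lext => a; rewrite raddfN. Qed.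

Lemma BY0l v : BY n 0 v = 0.
Proof. by rewrite !BYE raddf0. Qed.

Lemma BY0r u : BY n u 0 = 0.
Proof. by rewrite -(subrr 0) BYDr BYNr subrr. Qed.

Lemma BYMzl u v m : BY n (u *~ m) v = BY n u v * m.
Proof. by rewrite !BYE raddfMz -mulrzr intz. Qed.

Lemma BYMnr u v (m : nat) : BY n u (v *+ m) = BY n u v *+ m.
Proof. by elim: m => [|m IH]; rewrite ?mulr0n ?BY0r // !mulrS BYDr IH. Qed.

Lemma BYMzr u v m : BY n u (v *~ m) = BY n u v * m.
Proof.
rewrite -[m in RHS]intz mulrzr.
by case: m => m; rewrite ?NegzE ?mulrNz ?BYNr -!pmulrn BYMnr.
Qed.

Lemma BY_suml I (s : seq I) (P : pred I) (F : I -> Yexp) v :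
  BY n (\sum_(i <- s | P i) F i) v = \sum_(i <- s | P i) BY n (F i) v.
Proof. by apply: (big_morph (BY n ^~ v)); [move=> *; apply: BYDl | apply: BY0l]. Qed.

Lemma BY_sumr I (s : seq I) (P : pred I) (F : I -> Yexp) u :
  BY n u (\sum_(i <- s | P i) F i) = \sum_(i <- s | P i) BY n u (F i).
Proof. by apply: (big_morph (BY n u)); [move=> *; apply: BYDr | apply: BY0r]. Qed.
End BYTheory.

(** * The subalgebra generated by a set of variables *)

Section Subalgebra.
Variables (n : nat) (S : seq (nat * int)).

(** Quantified over all powers of [t], so that the power [BY n u v] created by a product of
    monomials can be absorbed. *)
Definition subspan (u : Yexp) := forall k, in_gen_subalg n S (qmono k u).

Lemma subspan0 : subspan 0.
Proof. by move=> k; apply: gsa_tpow. Qed.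

Lemma subspanD u v : subspan u -> subspan v -> subspan (u + v).
Proof.
move=> hu hv k.
have -> : qmono k (u + v) = Ymul n (qmono (k - BY n u v) u) (qmono 0 v).
  by rewrite /Ymul qmul_mono addr0 subrK.
exact: gsa_mul.
Qed.

Lemma tildeY_inv a : gammaB n a a = 0 ->
  Ymul n (tildeY n a) (qmono (-1) (- << a >>)) = qone _ /\
  Ymul n (qmono (-1) (- << a >>)) (tildeY n a) = qone _.
Proof.
move=> e; pose u : Yexp := << a >>.
have e1 : BY n u (- u) = 0 by rewrite (BYNr n u u) BYU e oppr0.
have e2 : BY n (- u) u = 0 by rewrite (BYNl n u u) BYU e oppr0.
split; rewrite /Ymul /tildeY -/u qmul_mono.
  by rewrite e1 (subrr u).
by rewrite e2 (addNr u).
Qed.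

Lemma subspan_gen a : a \in S -> subspan << a >>.
Proof.
move=> aS k.
have -> : qmono k << a >> = Ymul n (qmono (k - 1) 0) (tildeY n a).
  by rewrite /Ymul /tildeY qmul_mono BY0l addr0 subrK add0r.
by apply: gsa_mul; [apply: gsa_tpow | apply: gsa_gen].
Qed.

Lemma subspan_geninv a : a \in S -> gammaB n a a = 0 -> subspan (- << a >>).
Proof.
move=> aS e k.
have -> : qmono k (- << a >>) = Ymul n (qmono (k + 1) 0) (qmono (-1) (- << a >>)).
  by rewrite /Ymul qmul_mono BY0l addr0 addrK add0r.
apply: gsa_mul; first exact: gsa_tpow.
by have [e1 e2] := tildeY_inv a e; apply: (gsa_inv n S a).
Qed.

Lemma in_gen_subalg_sum I (s : seq I) (F : I -> Yt n) :
  (forall i, in_gen_subalg n S (F i)) -> in_gen_subalg n S (\sum_(i <- s) F i).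
Proof.
move=> hF; elim/big_ind: _ => [|x y|i _]; [exact: gsa_0|exact: gsa_add|exact: hF].
Qed.

Lemma in_gen_subalgMz x (m : int) : in_gen_subalg n S x -> in_gen_subalg n S (x *~ m).
Proof.
move=> hx; have hn k : in_gen_subalg n S (x *+ k).
  by elim: k => [|k IH]; rewrite ?mulr0n ?mulrS; [exact: gsa_0|exact: gsa_add].
by case: m => k; rewrite ?NegzE ?mulrNz -pmulrn //; apply: gsa_opp.
Qed.

Lemma subspan_sum I (s : seq I) (P : pred I) (F : I -> Yexp) :
  (forall i, P i -> subspan (F i)) -> subspan (\sum_(i <- s | P i) F i).
Proof.
move=> hF; elim/big_ind: _ => [|x y|i /hF]; [exact: subspan0|exact: subspanD|by []].
Qed.

Lemma subspanMz u (m : int) : subspan u -> subspan (- u) -> subspan (u *~ m).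
Proof.
move=> hu hNu; have hn v k : subspan v -> subspan (v *+ k).
  by move=> hv; elim: k => [|k IH]; rewrite ?mulr0n ?mulrS; [exact: subspan0|exact: subspanD].
by case: m => k; rewrite ?NegzE ?mulrNz -pmulrn -?mulNrn; apply: hn.
Qed.

End Subalgebra.

Section SubalgebraImage.
Variables (K : zmodType) (B : K -> K -> int) (phi : {additive K -> Yexp}).
Variables (n : nat) (S : seq (nat * int)).
Hypothesis phiB : forall u v, BY n (phi u) (phi v) = - B u v.
Hypothesis gammaS : forall a, a \in S -> gammaB n a a = 0.
Hypothesis phiS : forall u, subspan n S (phi u).
Hypothesis phi_onto : forall a, a \in S -> exists u, phi u = << a >>.

Lemma tmap_image y :
  in_gen_subalg n S y <-> exists x, tmap K Yexp phi x = y.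
Proof.
split=> [|[x <-]].
  elim=> {y} [k||a aS|a y aS e1 e2|x _ [z <-]|x y _ [z <-] _ [z' <-]
    |x y _ [z <-] _ [z' <-]].
  - by exists (qmono (- k) 0); rewrite tmap_mono raddf0 opprK.
  - by exists 0; rewrite /tmap raddf0.
  - have [u eu] := phi_onto _ aS.
    by exists (qmono (-1) u); rewrite tmap_mono eu.
  - have [u eu] := phi_onto _ aS; exists (qmono 1 (- u)).
    have [h1 _] := tildeY_inv n a (gammaS a aS).
    rewrite tmap_mono (raddfN phi u) eu.
    (* Both elements are right inverses of the monomial [tildeY n a]. *)
    exact: (@qmul_mono_inj _ (BY n) 1 << a >> _ _ (etrans h1 (esym e1))).
  - by exists (- z); rewrite /tmap raddfN.
  - by exists (z + z'); rewrite /tmap raddfD.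
  - by exists (qmul B z z'); rewrite (@tmap_mul _ _ B (BY n)).
rewrite [x]monalgE /tmap raddf_sum; apply: in_gen_subalg_sum => -[k u] /=.
rewrite malgU_mulz raddfMz; apply: in_gen_subalgMz.
rewrite [X in in_gen_subalg _ _ X](tmap_mono K Yexp phi k u).
exact: phiS.
Qed.
End SubalgebraImage.

(** * The periodic form behind the inverse quantum Cartan matrix *)

(** The value at [x - y] models the inner product of [e_x] and [e_y] for vectors subject to
    [e_(y + 2 m) = - e_y]. *)
Definition eper (m y : int) : int :=
  ((4 * m %| y)%Z)%:R - ((4 * m %| y - 2 * m)%Z)%:R.

Lemma dvdz_shift (d a b : int) : (d %| a - b)%Z -> (d %| a)%Z = (d %| b)%Z.
Proof. by move=> dab; rewrite -[a in LHS](subrK b); apply: rpredDl. Qed.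

Lemma dvdz_opp (d a : int) : (d %| - a)%Z = (d %| a)%Z.
Proof. exact: rpredN. Qed.

Lemma eper_eq (m x y : int) : x = y -> eper m x = eper m y.
Proof. by move->. Qed.

Lemma eper_half (m y : int) : eper m (y + 2 * m) = - eper m y.
Proof.
rewrite /eper addrK opprB; congr (_ - _); congr ((nat_of_bool _)%:R).
by apply: dvdz_shift; apply/dvdzP; exists 1; ring.
Qed.

Lemma eper_halfN (m y : int) : eper m (y - 2 * m) = - eper m y.
Proof. by rewrite -[y in RHS](subrK (2 * m)) eper_half opprK. Qed.

Lemma eperN (m y : int) : eper m (- y) = eper m y.
Proof.
rewrite /eper dvdz_opp; congr (_ - _); congr ((nat_of_bool _)%:R).
rewrite -dvdz_opp; apply: dvdz_shift; apply/dvdzP; exists 1; ring.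
Qed.

Lemma eper_odd (m y : int) : ~~ (2 %| y)%Z -> eper m y = 0.
Proof.
move=> hy; have d z : (2 %| y - z)%Z -> (4 * m %| z)%Z = false.
  by move=> h2; apply/negP => /dvdzP [q e]; lia.
by rewrite /eper (d y) ?subrr // d ?subrr //; apply/dvdzP; exists m; ring.
Qed.

Lemma eper_small (m y : int) : - (2 * m) < y -> y < 2 * m -> eper m y = (y == 0)%:R.
Proof.
move=> hl hu.
have multF z : - (4 * m) < z -> z < 4 * m -> z != 0 -> (4 * m %| z)%Z = false.
  move=> zl zu z0; apply/negP => /dvdzP [q e].
  have [q0|[q0|q0]] : q = 0 \/ q <= -1 \/ 1 <= q by lia.
  - by rewrite q0 mul0r in e; rewrite e in z0.
  - by nia.
  - by nia.
rewrite /eper (multF (y - 2 * m)) ?subr0; [|lia..].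
by have [->|y0] := eqVneq y 0; rewrite ?dvdz0 // multF //; lia.
Qed.

Section InverseCartan.
Variable n : nat.
Hypothesis hn : (2 <= n)%N.
Local Notation h := (2 * n%:Z - 1 : int).
Local Notation E := (eper h).

(** For [i, j < n] and [x = p - q], the inner product of [e_(p + 2 i) - e_(p - 2 i)] and
    [e_(q + 2 j) - e_(q - 2 j)]. In row [n] the root involves [e_(q + h)] and one extra vector; the
    latter accounts for the term [eper 1 x]. *)
Definition PB (i j : nat) (x : int) : int :=
  if (i < n)%N then
    if (j < n)%N then E (x + 2 * i%:Z - 2 * j%:Z) - E (x - 2 * i%:Z - 2 * j%:Z)
      - E (x + 2 * i%:Z + 2 * j%:Z) + E (x - 2 * i%:Z + 2 * j%:Z)
    else E (x + 2 * i%:Z - h) - E (x - 2 * i%:Z - h)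
  else if (j < n)%N then E (x + 2 * j%:Z - h) - E (x - 2 * j%:Z - h)
  else E x + eper 1 x.

Lemma PB_even i j (x : int) : PB i j (- x) = PB i j x.
Proof.
rewrite /PB; case: ifP => hi; case: ifP => hj.
- rewrite -(eperN _ (- x + _ - _)) -(eperN _ (- x - _ - _)).
  rewrite -(eperN _ (- x + _ + _)) -(eperN _ (- x - _ + _)).
  rewrite (eper_eq _ (- (- x + 2 * i%:Z - 2 * j%:Z)) (x - 2 * i%:Z + 2 * j%:Z)); last ring.
  rewrite (eper_eq _ (- (- x - 2 * i%:Z - 2 * j%:Z)) (x + 2 * i%:Z + 2 * j%:Z)); last ring.
  rewrite (eper_eq _ (- (- x + 2 * i%:Z + 2 * j%:Z)) (x - 2 * i%:Z - 2 * j%:Z)); last ring.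
  rewrite (eper_eq _ (- (- x - 2 * i%:Z + 2 * j%:Z)) (x + 2 * i%:Z - 2 * j%:Z)); last ring.
  ring.
- rewrite -(eperN _ (- x + _ - _)) -(eperN _ (- x - _ - _)).
  rewrite (eper_eq _ (- (- x + 2 * i%:Z - h)) ((x - 2 * i%:Z - h) + 2 * h)); last ring.
  rewrite (eper_eq _ (- (- x - 2 * i%:Z - h)) ((x + 2 * i%:Z - h) + 2 * h)); last ring.
  by rewrite !eper_half; ring.
- rewrite -(eperN _ (- x + _ - _)) -(eperN _ (- x - _ - _)).
  rewrite (eper_eq _ (- (- x + 2 * j%:Z - h)) ((x - 2 * j%:Z - h) + 2 * h)); last ring.
  rewrite (eper_eq _ (- (- x - 2 * j%:Z - h)) ((x + 2 * j%:Z - h) + 2 * h)); last ring.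
  by rewrite !eper_half; ring.
- by rewrite !eperN.
Qed.

Lemma PB_sym i j (x : int) : PB i j x = PB j i x.
Proof.
rewrite /PB; case: ifP => hi; case: ifP => hj //.
rewrite (eper_eq _ (x + 2 * j%:Z - 2 * i%:Z) (x - 2 * i%:Z + 2 * j%:Z)); last ring.
rewrite (eper_eq _ (x - 2 * j%:Z - 2 * i%:Z) (x - 2 * i%:Z - 2 * j%:Z)); last ring.
rewrite (eper_eq _ (x + 2 * j%:Z + 2 * i%:Z) (x + 2 * i%:Z + 2 * j%:Z)); last ring.
rewrite (eper_eq _ (x - 2 * j%:Z + 2 * i%:Z) (x + 2 * i%:Z - 2 * j%:Z)); last ring.
ring.
Qed.

Lemma PB0 i (x : int) : PB i 0 x = 0.
Proof.
have n0 : (0 < n)%N by lia.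
by rewrite /PB n0; case: ifP => _; rewrite mulr0 !(addr0, subr0); ring.
Qed.

Lemma PB_col i : exists f : int -> int, [/\ forall x : int, f (x + 2 * h) = - f x,
  forall j x, (j < n)%N -> PB i j x = f (x - 2 * j%:Z) - f (x + 2 * j%:Z),
  (i < n)%N -> forall x, PB i n x = f (x - h) &
  (n <= i)%N -> forall x, PB i n x = f (x - h) + eper 1 x].
Proof.
have [hi|hi] := ltnP i n.
  exists (fun x => E (x + 2 * i%:Z) - E (x - 2 * i%:Z)); split => // [x|j x hj|_ x].
  - rewrite (eper_eq _ (x + 2 * h + _) (x + 2 * i%:Z + 2 * h)); last ring.
    rewrite (eper_eq _ (x + 2 * h - _) (x - 2 * i%:Z + 2 * h)); last ring.
    by rewrite !eper_half; ring.
  - rewrite /PB hi hj.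
    rewrite (eper_eq _ (x - 2 * j%:Z + _) (x + 2 * i%:Z - 2 * j%:Z)); last ring.
    rewrite (eper_eq _ (x - 2 * j%:Z - _) (x - 2 * i%:Z - 2 * j%:Z)); last ring.
    rewrite (eper_eq _ (x + 2 * j%:Z + _) (x + 2 * i%:Z + 2 * j%:Z)); last ring.
    rewrite (eper_eq _ (x + 2 * j%:Z - _) (x - 2 * i%:Z + 2 * j%:Z)); last ring.
    ring.
  - rewrite /PB hi ltnn.
    by congr (E _ - E _); ring.
exists (fun x => E (x + h)); split => [x|j x hj||_ x].
- rewrite (eper_eq _ (x + 2 * h + _) (x + h + 2 * h)); last ring.
  by rewrite eper_half.
- rewrite /PB ltnNge hi hj /=.
  rewrite (eper_eq _ (x - 2 * j%:Z - h) ((x - 2 * j%:Z + h) - 2 * h)); last ring.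
  rewrite (eper_eq _ (x + 2 * j%:Z - h) ((x + 2 * j%:Z + h) - 2 * h)); last ring.
  by rewrite !eper_halfN; ring.
- by [].

- by rewrite /PB ltnNge hi ltnn subrK.
Qed.

Lemma PB_rec_lt i j (x : int) : (0 < j)%N -> (j.+1 < n)%N ->
  PB i j (x - 2) + PB i j (x + 2) = PB i j.-1 x + PB i j.+1 x.
Proof.
move=> j0 jn; have [f [_ fE _ _]] := PB_col i; rewrite !fE; try lia.
rewrite (_ : x - 2 - 2 * j%:Z = x - 2 * j.+1%:Z); last lia.
rewrite (_ : x - 2 + 2 * j%:Z = x + 2 * j.-1%:Z); last lia.
rewrite (_ : x + 2 - 2 * j%:Z = x - 2 * j.-1%:Z); last lia.
rewrite (_ : x + 2 + 2 * j%:Z = x + 2 * j.+1%:Z); last lia.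
ring.
Qed.

Lemma PB_rec_pred i (x : int) :
  PB i n.-1 (x - 2) + PB i n.-1 (x + 2) = PB i n.-2 x + PB i n (x - 1) + PB i n (x + 1).
Proof.
have [f [f2h fE fn fn']] := PB_col i; rewrite (fE n.-1) ?(fE n.-1 (x + 2)) ?(fE n.-2); try lia.
rewrite -[in RHS]addrA; have -> : PB i n (x - 1) + PB i n (x + 1) = f (x - 1 - h) + f (x + 1 - h).
  have [hi|hi] := ltnP i n; first by rewrite !fn.
  rewrite !fn' //.
  (* The two values of [eper 1] are half a period apart and cancel. *)
  have e := eper_half 1 (x - 1).
  by rewrite (_ : x + 1 = x - 1 + 2 * 1) ?e; ring.
rewrite (_ : x - 2 - 2 * n.-1%:Z = x - 1 - h); last lia.
rewrite (_ : x - 2 + 2 * n.-1%:Z = x + 2 * n.-2%:Z); last lia.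
rewrite (_ : x + 2 - 2 * n.-1%:Z = x - 2 * n.-2%:Z); last lia.
(* This wave has run past the end of the strip; the antiperiod [2 h] returns it to the profile of
   row [n]. *)
rewrite (_ : x + 2 + 2 * n.-1%:Z = x + 1 - h + 2 * h); last lia.
by rewrite f2h; ring.
Qed.

Lemma PB_rec_last i (x : int) : PB i n (x - 1) + PB i n (x + 1) = PB i n.-1 x.
Proof.
have [f [f2h fE fn fn']] := PB_col i; rewrite (fE n.-1); try lia.
have -> : PB i n (x - 1) + PB i n (x + 1) = f (x - 1 - h) + f (x + 1 - h).
  have [hi|hi] := ltnP i n; first by rewrite !fn.
  rewrite !fn' //.
  have e := eper_half 1 (x - 1).
  by rewrite (_ : x + 1 = x - 1 + 2 * 1) ?e; ring.
rewrite (_ : x - 2 * n.-1%:Z = x + 1 - h); last lia.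
rewrite (_ : x + 2 * n.-1%:Z = x - 1 - h + 2 * h); last lia.
by rewrite f2h; ring.
Qed.

Lemma PB_diag i j : (0 < i <= n)%N -> (0 < j <= n)%N ->
  PB i j 0 = 2 * (i == j)%:R.
Proof.
move=> hi hj; rewrite /PB; case: ifP => hi'; case: ifP => hj'.
- by rewrite !eper_small; try lia.
- by rewrite !eper_odd; try lia.
- by rewrite !eper_odd; try lia.
- by rewrite !eper_small; try lia.
Qed.

(** Used next to the cut at 0, where the truncated recursion meets values at -1 without a
    counterpart on the positive side. *)
Lemma PB_one i j : (0 < i <= n)%N -> (0 < j < n)%N ->
  PB i j (-1) = ((i == n) && (j == n.-1))%:R.
Proof.
move=> hi hj; rewrite /PB; case: ifP => hi'; case: ifP => hj'; try lia.
- rewrite !eper_odd; lia.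
- rewrite (eper_eq _ (-1 - 2 * j%:Z - h) ((h - 1 - 2 * j%:Z) - 2 * h)); last ring.
  by rewrite eper_halfN !eper_small; lia.
Qed.
End InverseCartan.

(** * The inverse quantum Cartan matrix *)

Section CartanInverse.
Variable n : nat.
Hypothesis hn : (2 <= n)%N.

(** The coefficient of [z^y] in [(z^{r_j} - z^{-r_j}) C(z)^{-1}_{ji}], as [ctilde_diff] confirms. At
    0 it is half of [PB]: the even function [PB] is cut in two. *)
Definition GB (j i : nat) (y : int) : int :=
  if y < 0 then PB n i j y else if y == 0 then (i == j)%:R else 0.

Lemma GB_neg j i (y : int) : y < 0 -> GB j i y = PB n i j y.
Proof. by rewrite /GB => ->. Qed.

Lemma GB_pos j i (y : int) : 0 < y -> GB j i y = 0.
Proof. by move=> y0; rewrite /GB ltNge ltW //= gt_eqF. Qed.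

Lemma GB_zero j i : GB j i 0 = (i == j)%:R.
Proof. by rewrite /GB ltxx eqxx. Qed.

Lemma GB0 i (y : int) : (0 < i)%N -> GB 0 i y = 0.
Proof.
move=> i0; rewrite /GB PB0 //; case: ifP => // _; case: ifP => // _.
by rewrite gtn_eqF.
Qed.

(** The conjugated Cartan matrix acting on coefficient families. Conjugation moves the factor
    [z + z^{-1}] from the entry [(n, n - 1)] to the entry [(n - 1, n)]. *)
Definition drow (X : nat -> int -> int) (j : nat) (y : int) : int :=
  if (j < n.-1)%N then X j (y - 2) + X j (y + 2) - X j.-1 y - X j.+1 y
  else if j == n.-1
  then X j (y - 2) + X j (y + 2) - X j.-1 y - X n (y - 1) - X n (y + 1)
  else X n (y - 1) + X n (y + 1) - X n.-1 y.

(** For [|y| >= 3] all arguments lie on one side of the cut, and the recursions of [PB], or zeros,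
    suffice. The remaining [y] follow from evenness and the values at 0 and -1; the right-hand side
    is the defect produced by the cut. *)
Lemma drow_GB i j (y : int) : (0 < i <= n)%N -> (0 < j <= n)%N ->
  drow (GB^~ i) j y = (i == j)%:R * ((y == rB n j)%:R - (y == - rB n j)%:R).
Proof.
move=> hi hj; rewrite /drow /rB.
(* Turns the product of indicators into case data that [lia] can use. *)
have rhs (d r : int) : 0 < r -> exists2 R : int,
    d * ((y == r)%:R - (y == - r)%:R) = R &
    R = 0 /\ y <> r /\ y <> - r \/ y = r /\ R = d \/ y = - r /\ R + d = 0.
  move=> r0; have [->|y1] := eqVneq y r.
    by exists d; [rewrite gt_eqF ?subr0 ?mulr1; lia | lia].
  have [->|y2] := eqVneq y (- r).
    by exists (- d); [rewrite sub0r mulrN1 | lia].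
  by exists 0; [rewrite subrr mulr0 | lia].
have diag k (a : int) : (0 < k <= n)%N -> a = 0 -> PB n i k a = 2 * (i == k)%:R.
  by move=> hk ->; apply: PB_diag.
have even k (a b : int) : a + b = 0 -> PB n i k a = PB n i k b.
  by move=> ab; rewrite -PB_even; congr PB; lia.
have one k (a : int) : (0 < k < n)%N -> a = -1 ->
    PB n i k a = ((i == n) && (k == n.-1))%:R.
  by move=> hk ->; apply: PB_one.
have Gp k (a : int) : 0 < a -> GB k i a = 0 by apply: GB_pos.
have Gn k (a : int) : a < 0 -> GB k i a = PB n i k a by apply: GB_neg.
have Gz k (a : int) : a = 0 -> GB k i a = (i == k)%:R by move=> ->; apply: GB_zero.
have PB00 (a : int) : PB n i 0 a = 0 by apply: PB0.
have Le := PB_rec_last n hn i y.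
case: ltnP => [hj1|hj1]; last case: eqVneq => [ej|nej].
- have jn : (j < n)%N by lia.
  rewrite jn; have [R -> HR] := rhs (i == j)%:R 2 isT.
  have L := PB_rec_lt n hn i j y ltac:(lia) ltac:(lia).
  have [y3|[y3|yy]] : 3 <= y \/ y <= -3 \/ -3 < y < 3 by lia.
  + by rewrite !Gp; lia.
  + by rewrite !Gn; lia.
  have [e|[e|[e|[e|e]]]] : y = 2 \/ y = 1 \/ y = 0 \/ y = -1 \/ y = -2 by lia.
  + by rewrite (Gz j) ?Gp; lia.
  + by rewrite (Gn j (y - 2)) ?Gp ?(one j); lia.
  + have e2 := even j (y - 2) (y + 2) ltac:(lia).
    rewrite (Gn j (y - 2)) ?(Gp j) ?(Gz j.-1) ?(Gz j.+1); try lia.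
    have d1 := diag j.+1 y ltac:(lia) e.
    have [j1|j1] : j = 1%N \/ (1 < j)%N by lia.
      by rewrite (_ : j.-1 = 0%N) ?PB00 in L *; lia.
    by have d2 := diag j.-1 y ltac:(lia) e; lia.
  + have e3 := one j y ltac:(lia) e.
    have e2 := even j (y + 2) y ltac:(lia).
    by rewrite (Gp j (y + 2)) ?Gn; lia.
  + have d1 := diag j (y + 2) ltac:(lia) ltac:(lia).
    by rewrite (Gz j (y + 2)) ?Gn; lia.
- have jn : (j < n)%N by lia.
  rewrite jn ej; have [R -> HR] := rhs (i == n.-1)%:R 2 isT.
  have L := PB_rec_pred n hn i y.
  have [y3|[y3|yy]] : 3 <= y \/ y <= -3 \/ -3 < y < 3 by lia.
  + by rewrite !Gp; lia.
  + by rewrite !Gn; lia.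
  have [e|[e|[e|[e|e]]]] : y = 2 \/ y = 1 \/ y = 0 \/ y = -1 \/ y = -2 by lia.
  + by rewrite (Gz n.-1) ?Gp; lia.
  + by rewrite (Gn n.-1 (y - 2)) ?(Gz n (y - 1)) ?Gp ?(one n.-1); lia.
  + have e2 := even n.-1 (y - 2) (y + 2) ltac:(lia).
    have e1 := even n (y - 1) (y + 1) ltac:(lia).
    rewrite (Gn n.-1 (y - 2)) ?(Gn n (y - 1)) ?(Gp n) ?(Gp n.-1) ?(Gz n.-2); try lia.
    have [j1|j1] : n.-2 = 0%N \/ (0 < n.-2)%N by lia.
      by rewrite j1 PB00 in L *; lia.
    by have d2 := diag n.-2 y ltac:(lia) e; lia.
  + have e3 := one n.-1 y ltac:(lia) e.
    have e2 := even n.-1 (y + 2) y ltac:(lia).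
    have d1 := diag n (y + 1) ltac:(lia) ltac:(lia).
    by rewrite (Gp n.-1 (y + 2)) ?(Gz n (y + 1)) ?Gn; lia.
  + have d1 := diag n.-1 (y + 2) ltac:(lia) ltac:(lia).
    by rewrite (Gz n.-1 (y + 2)) ?Gn; lia.
- have {hj1 nej} -> : j = n by lia.
  rewrite ltnn; have [R -> HR] := rhs (i == n)%:R 1 isT.
  have [y3|[y3|yy]] : 2 <= y \/ y <= -2 \/ -2 < y < 2 by lia.
  + by rewrite !Gp; lia.
  + by rewrite !Gn; lia.
  have [e|[e|e]] : y = 1 \/ y = 0 \/ y = -1 by lia.
  + by rewrite (Gz n (y - 1)) ?Gp; lia.
  + have e1 := even n (y - 1) (y + 1) ltac:(lia).
    have d1 := diag n.-1 y ltac:(lia) e.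
    by rewrite (Gn n (y - 1)) ?(Gp n) ?(Gz n.-1); lia.
  + have d1 := diag n (y + 1) ltac:(lia) ltac:(lia).
    by rewrite (Gz n (y + 1)) ?Gn; lia.
Qed.

(** Evaluated at [y + 2], or at [y + 1] in row [n], a row expresses the coefficient at [y] through
    coefficients at larger arguments; hence an induction downwards from [N]. *)
Lemma drow_inj (X Y : nat -> int -> int) (N : int) :
  X 0%N =1 Y 0%N ->
  (forall j (y : int), (j <= n)%N -> N < y -> X j y = Y j y) ->
  (forall j (y : int), (0 < j <= n)%N -> drow X j y = drow Y j y) ->
  forall j (y : int), (j <= n)%N -> X j y = Y j y.
Proof.
move=> XY0 XYN XYd.
suff H (m : nat) j (y : int) : (j <= n)%N -> N - m%:Z < y -> X j y = Y j y.
  move=> j y hj; apply: (H `|N - y|.+1) => //; lia.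
elim: m j y => [|m IH] j y hj hy; first by apply: XYN => //; lia.
have [->|j0] := posnP j; first exact: XY0.
have Xlt k : (k < n)%N -> X k y = Y k y.
  have [->|k0] := posnP k; first by move=> _; apply: XY0.
  move=> kn; have := XYd k (y + 2) ltac:(lia); rewrite /drow addrK.
  case: ltnP => hk; last case: eqVneq => ek; last lia.
  - rewrite !(IH _ (y + 2)) ?(IH _ (y + 2 + 2)); lia.
  - rewrite !(IH _ (y + 2)) ?(IH _ (y + 2 + 2)) ?(IH n); lia.
have [ltjn|lenj] := ltnP j n; first exact: Xlt.
have -> : j = n by lia.
have := XYd n (y + 1) ltac:(lia); rewrite /drow addrK ltnNge leq_pred /=.
rewrite gtn_eqF; last lia.
by rewrite (IH n.-1) ?(IH n (y + 1 + 1)); lia.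
Qed.

Definition crow (X : nat -> int -> int) (j : nat) (r : int) : int :=
  \sum_(1 <= k < n.+1) \sum_(p <- [:: -2; -1; 0; 1; 2])
     Ccoef n j k p * X k (r - p).

Lemma crowE (X : nat -> int -> int) j (r : int) : (0 < j <= n)%N -> (forall r, X 0%N r = 0) ->
  crow X j r = if (j < n)%N then X j (r - 2) + X j (r + 2) - X j.-1 r - X j.+1 r
    else X n (r - 1) + X n (r + 1) - X n.-1 (r - 1) - X n.-1 (r + 1).
Proof.
move=> hj X0; rewrite /crow.
pose T k : int := \sum_(p <- [:: -2; -1; 0; 1; 2]) Ccoef n j k p * X k (r - p).
have TE k : T k = Ccoef n j k (-2) * X k (r + 2) + Ccoef n j k (-1) * X k (r + 1)
   + Ccoef n j k 0 * X k r + Ccoef n j k 1 * X k (r - 1) + Ccoef n j k 2 * X k (r - 2).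
  by rewrite /T !big_cons big_nil !opprK subr0 addr0 !addrA.
(* The Cartan matrix is tridiagonal. *)
have -> : \sum_(1 <= k < n.+1) T k = \sum_(1 <= k < n.+1 | k == j) T k
    + \sum_(1 <= k < n.+1 | k == j.-1) T k + \sum_(1 <= k < n.+1 | k == j.+1) T k.
  rewrite [X in _ = X + _ + _]big_mkcond [X in _ = _ + X + _]big_mkcond.
  rewrite [X in _ = _ + _ + X]big_mkcond -!big_split; apply: eq_big_nat => k hk /=.
  have [->|kj] := eqVneq k j.
    by rewrite !ifF ?addr0 //; lia.
  have [->|kj1] := eqVneq k j.-1; first by rewrite ifF ?addr0 ?add0r //; lia.
  have [->|kj2] := eqVneq k j.+1; first by rewrite !add0r.
  rewrite !addr0 TE /Ccoef (_ : (j == k) = false); last lia.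
  rewrite /cartanB ifF; last lia.
  do 3 (rewrite ifF; last lia).
  by rewrite /qint_coef sgr0 !mul0r !addr0.
rewrite !big_nat1_eq.
have -> : (if (1 <= j < n.+1)%N then T j else 0) =
          X j (r - rB n j) + X j (r + rB n j).
  rewrite ifT; last lia.
  rewrite TE /Ccoef eqxx /rB; case: ifP => _.
    by transitivity (1 * X j (r + 2) + 0 * X j (r + 1) + 0 * X j r
        + 0 * X j (r - 1) + 1 * X j (r - 2)); last ring.
  by transitivity (0 * X j (r + 2) + 1 * X j (r + 1) + 0 * X j r
      + 1 * X j (r - 1) + 0 * X j (r - 2)); last ring.
have -> : (if (1 <= j.-1 < n.+1)%N then T j.-1 else 0) =
   if (j < n)%N then - X j.-1 r else - X n.-1 (r - 1) - X n.-1 (r + 1).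
  have [hj1|hj1] := ltnP 1 j; last first.
    have -> : j = 1%N by lia.
    by rewrite /= ifT ?X0 ?oppr0 //; lia.
  rewrite ifT; last lia.
  rewrite TE /Ccoef (_ : (j == j.-1) = false); last lia.
  rewrite /cartanB ifF; last lia.
  rewrite ifF; last lia.
  case: ltnP => hj2.
    rewrite ifF; last lia.
    rewrite ifT; last lia.
    by transitivity (0 * X j.-1 (r + 2) + 0 * X j.-1 (r + 1) + (-1) * X j.-1 r
        + 0 * X j.-1 (r - 1) + 0 * X j.-1 (r - 2)); last ring.
  have -> : j = n by lia.
  rewrite !eqxx /=.
  by transitivity (0 * X n.-1 (r + 2) + (-1) * X n.-1 (r + 1) + 0 * X n.-1 r
      + (-1) * X n.-1 (r - 1) + 0 * X n.-1 (r - 2)); last ring.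
have -> : (if (1 <= j.+1 < n.+1)%N then T j.+1 else 0) =
   if (j < n)%N then - X j.+1 r else 0.
  rewrite (_ : (1 <= j.+1 < n.+1)%N = (j < n)%N); last lia.
  case: ltnP => // hj2.
  rewrite TE /Ccoef /cartanB (_ : (j == j.+1) = false); last lia.
  rewrite (_ : ~~ _ = false); last lia.
  rewrite (_ : _ && _ = false); last lia.
  rewrite (_ : _ || _ = true); last lia.
  by transitivity (0 * X j.+1 (r + 2) + 0 * X j.+1 (r + 1) + (-1) * X j.+1 r
      + 0 * X j.+1 (r - 1) + 0 * X j.+1 (r - 2)); last ring.
rewrite /rB; case: ltnP => hj2; first by ring.
have -> : j = n by lia.
ring.
Qed.

(* Conjugating the Cartan matrix by [diag (z^{r_j} - z^{-r_j})] turns [crow] into [drow]. *)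
Definition dX (X : nat -> int -> int) (j : nat) (y : int) : int :=
  X j (y - rB n j) - X j (y + rB n j).

Lemma drow_dX (X : nat -> int -> int) j (y : int) :
  (0 < j <= n)%N -> (forall r, X 0%N r = 0) ->
  drow (dX X) j y = crow X j (y - rB n j) - crow X j (y + rB n j).
Proof.
move=> hj X0; rewrite !crowE // /drow /dX.
have rn : rB n n = 1 by rewrite /rB ltnn.
have rlt k : (k < n)%N -> rB n k = 2 by rewrite /rB => ->.
have e1 : y - 1 - 1 = y - 2 by lia.
have e2 : y + 1 + 1 = y + 2 by lia.
have e3 : y - 2 + 2 = y by lia.
have e4 : y + 2 - 2 = y by lia.
have e5 : y - 1 + 1 = y by lia.
have e6 : y + 1 - 1 = y by lia.
case: ltnP => hj1; last case: eqVneq => ej.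
- rewrite (_ : (j < n)%N = true) ?(rlt j) ?(rlt j.-1) ?(rlt j.+1); try lia.
  by rewrite e3 e4; ring.
- rewrite (_ : (j < n)%N = true) ?(rlt j) ?(rlt j.-1) ?rn; try lia.
  by rewrite (_ : j.+1 = n) ?e1 ?e2 ?e3 ?e4 ?e5 ?e6; [ring | lia].
- have -> : j = n by lia.
  rewrite ltnn rn rlt; last lia.
  by rewrite e1 e2 e5 e6; ring.
Qed.

(** Division by [z^r - z^{-r}] among series bounded above, using [1 / (z^r - z^{-r}) = \sum_k z^{-r
    (2 k + 1)}]. Terms with [k > |y|] vanish, since [GB] is 0 at positive arguments. *)
Definition cB (j i : nat) (y : int) : int :=
  if (1 <= j <= n)%N && (1 <= i <= n)%N then
    \sum_(k < `|y|.+1) GB j i (y + rB n j * (2 * k%:Z + 1))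
  else 0.

Lemma rB_gt0 j : 0 < rB n j.
Proof. by rewrite /rB; case: ifP. Qed.

Lemma cBw j i (y : int) (N : nat) : (1 <= j <= n)%N -> (1 <= i <= n)%N ->
  (`|y| < N)%N -> cB j i y = \sum_(k < N) GB j i (y + rB n j * (2 * k%:Z + 1)).
Proof.
move=> hj hi; rewrite /cB hj hi; elim: N => // N IH.
rewrite ltnS leq_eqVlt => /predU1P [-> //|yN].
rewrite [RHS]big_ord_recr /= -IH // GB_pos ?addr0 //.
by have := rB_gt0 j; nia.
Qed.

Lemma dX_cB j i (y : int) : (0 < j <= n)%N -> (0 < i <= n)%N ->
  dX (cB^~ i) j y = GB j i y.
Proof.
move=> hj hi; rewrite /dX; set r := rB n j.
have r0 : 0 < r := rB_gt0 j.
pose N := (`|y| + `|r|).+1.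
rewrite (cBw _ _ _ N.+1) // ?(cBw _ _ (y + r) N) //; try lia.
rewrite big_ord_recl /= -/r mulr0 add0r mulr1 subrK -addrA.
rewrite -sumrB big1 ?addr0 // => k _; apply/eqP; rewrite subr_eq0.
by apply/eqP; congr GB; rewrite /bump /= add1n -/r; lia.
Qed.

Lemma cB_inv : is_Cinv n cB.
Proof.
split; first by move=> j i r /negbTE e; rewrite /cB e.
have cpos j i (r : int) : 0 < r -> cB j i r = 0.
  move=> r0; rewrite /cB; case: ifP => // _; apply: big1 => k _.
  by apply: GB_pos; have := rB_gt0 j; nia.
split; first by move=> j i; exists 0 => r; apply: cpos.
move=> j i r hj hi; rewrite -/(crow (cB^~ i) j r).
have c0 r' : cB 0 i r' = 0 by rewrite /cB.
(* The defect of the inverse equation is killed by the factor [z^{r_j} - z^{-r_j}] and vanishes for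
   large [y], so it is 0. *)
pose D (y : int) := crow (cB^~ i) j y - ((j == i) && (y == 0))%:R.
suff : D r = 0 by move/eqP; rewrite subr_eq0 => /eqP.
have Dpos (y : int) : 3 < y -> D y = 0.
  move=> y3; rewrite /D crowE //; case: ifP => _; rewrite !cpos; lia.
have Dstep (y : int) : D (y - rB n j) = D (y + rB n j).
  have := drow_dX (cB^~ i) j y hj c0.
  have -> : drow (dX (cB^~ i)) j y = drow (GB^~ i) j y.
    have dE k y' : (k <= n)%N -> dX (cB^~ i) k y' = GB k i y'.
      have [-> _|k0 kn] := posnP k; last by apply: dX_cB; rewrite ?k0.
      by rewrite /dX !c0 subrr GB0 //; case/andP: hi.
    have := leq_pred n; rewrite /drow; case: ifP => h1; last case: ifP => h2.
    - by rewrite !dE //; lia.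
    - by rewrite !dE //; lia.
    - by rewrite !dE //; lia.
  rewrite drow_GB // /D; have := rB_gt0 j; rewrite (eq_sym i).
  have -> : (y - rB n j == 0) = (y == rB n j) by lia.
  have -> : (y + rB n j == 0) = (y == - rB n j) by lia.
  case: (j == i) => /=; lia.
suff H (m : nat) (y : int) : 3 - m%:Z < y -> D y = 0.
  by apply: (H `|3 - r|.+1); lia.
elim: m y => [|m IH] y hy; first by apply: Dpos; lia.
rewrite -[y](addrK (rB n j)) Dstep; apply: IH.
by have := rB_gt0 j; lia.
Qed.

Lemma ctilde_inv : is_Cinv n (ctilde n).
Proof. by apply: epsilon_spec; exists cB; apply: cB_inv. Qed.

(** Both sides solve the same conjugated system and vanish above some bound, so [drow_inj]
    identifies them. *)
Lemma ctilde_diff j i (y : int) : (0 < j <= n)%N -> (0 < i <= n)%N ->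
  ctilde n j i (y - rB n j) - ctilde n j i (y + rB n j) = GB j i y.
Proof.
move=> hj hi; have [cout [cbd cinv]] := ctilde_inv.
have c0 r : ctilde n 0 i r = 0 by rewrite cout.
have [N HN] : exists N : int, forall k (y : int), (k <= n)%N -> N < y -> ctilde n k i y = 0.
  suff H m : exists N : int, forall k (y : int), (k < m)%N -> N < y -> ctilde n k i y = 0.
    by have [N HN] := H n.+1; exists N.
  elim: m => [|m [N HN]]; first by exists 0.
  have [N' HN'] := cbd m i; exists (Num.max N N') => k y'.
  rewrite ltnS leq_eqVlt gt_max => /predU1P [->|km] /andP [yN yN']; first exact: HN'.
  exact: HN.
(* The 2 absorbs the shift by [rB n k] in [dX]; the absolute value keeps the bound in the range
   where [GB] vanishes. *)
apply: (drow_inj (dX (ctilde n ^~ i)) (GB^~ i) (`|N| + 2)); last by lia.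
- by move=> y'; rewrite /dX !c0 subrr GB0 //; lia.
- move=> k y' hk hy; have rb : 0 < rB n k <= 2 by rewrite /rB; case: ifP.
  by rewrite /dX !HN ?GB_pos ?subrr //; lia.
move=> k y' hk; rewrite drow_dX // drow_GB //.
by rewrite /crow !cinv //; lia.
Qed.

Lemma gammaBE i j (r s : int) : (0 < i <= n)%N -> (0 < j <= n)%N ->
  gammaB n (i, r) (j, s) = GB j i (s - r) - GB j i (r - s).
Proof.
move=> hi hj; rewrite -!ctilde_diff // /gammaB.
rewrite (_ : (- rB n j - r + s)%R = (s - r - rB n j)%R :> int); last ring.
rewrite (_ : (rB n j + r - s)%R = (r - s + rB n j)%R :> int); last ring.
rewrite (_ : (rB n j - r + s)%R = (s - r + rB n j)%R :> int); last ring.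
rewrite (_ : (- rB n j + r - s)%R = (r - s - rB n j)%R :> int); last ring.
ring.
Qed.

Lemma gammaB_skew a b : (0 < a.1 <= n)%N -> (0 < b.1 <= n)%N ->
  gammaB n a b = - gammaB n b a.
Proof.
case: a b => i r [j s] hi hj; rewrite !gammaBE // opprB.
by rewrite /GB PB_sym // [PB n i j (r - s)]PB_sym // (eq_sym i).
Qed.

Lemma gammaB_self a : (0 < a.1 <= n)%N -> gammaB n a a = 0.
Proof. by case: a => i r hi; rewrite gammaBE // subrr. Qed.

(** For [s < r] the second term of [gammaBE] lies past the cut. For [s = r] both sides vanish, as
    the pairs differ and [PB] is diagonal at 0. *)
Lemma gammaB_PB i j (r s : int) : (0 < i <= n)%N -> (0 < j <= n)%N ->
  s <= r -> (i, r) != (j, s) -> gammaB n (i, r) (j, s) = PB n i j (r - s).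
Proof.
move=> hi hj; rewrite le_eqVlt gammaBE // xpair_eqE => /predU1P [->|sr] ne.
  by rewrite !subrr PB_diag //; move: ne; rewrite eqxx andbT => /negbTE ->.
rewrite GB_neg ?subr_lt0 // GB_pos ?subr_gt0 // subr0.
by rewrite -(opprB r s) PB_even.
Qed.
End CartanInverse.

(** * Root pairings and the matrix Lambda *)

Section RootPairing.
Variables (n : nat) (word : seq nat).
Hypothesis word_bd : forall c, (c < size word)%N -> (0 < nth 0%N word c < 2 * n)%N.

Definition sw (i x : nat) : nat :=
  if x == i then i.+1 else if x == i.+1 then i else x.

Lemma swK i : involutive (sw i).
Proof.
move=> x; rewrite /sw; case: (eqVneq x i) => [->|xi]; first by rewrite eqxx gtn_eqF.
by case: (eqVneq x i.+1) => [->|/negbTE ->]; rewrite ?eqxx // (negbTE xi).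
Qed.

(** [wpos w] is the permutation on basis vectors, [spos w] its inverse, which acts on
    coordinates. *)
Definition spos (w : seq nat) (j : nat) : nat := foldl (fun x i => sw i x) j w.
Definition wpos (w : seq nat) (x : nat) : nat := foldr sw x w.

Lemma wactE w v j : wact w v j = v (spos w j).
Proof. by elim: w j => // i w IH j; rewrite /= /sref IH. Qed.

Lemma sposK w : cancel (wpos w) (spos w).
Proof. by elim: w => // i w IH x; rewrite /spos /wpos /= swK; apply: IH. Qed.

Lemma wposK w : cancel (spos w) (wpos w).
Proof.
elim: w => // i w IH x.
by rewrite /spos /wpos /= -/(spos w _) -/(wpos w _) IH swK.
Qed.

Lemma wpos_inj w : injective (wpos w).
Proof. exact: can_inj (sposK w). Qed.

Lemma wpos_bd m x : (0 < x <= 2 * n)%N -> (0 < wpos (take m word) x <= 2 * n)%N.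
Proof.
move=> hx; rewrite /wpos; elim: m x hx => [|m IH] x hx; first by rewrite take0.
have [hm|hm] := ltnP m (size word); last first.
  by rewrite take_oversize ?(leq_trans hm) // -(take_oversize hm) IH.
rewrite (take_nth 0%N) // foldr_rcons; apply: IH.
by have := word_bd m hm; rewrite /sw; case: eqP => // ?; [lia | case: eqP; lia].
Qed.

(** [rtop c] and [rbot c] are the initial positions of the two wires that meet at position [c] of
    the word. *)
Definition rtop c := wpos (take c word) (nth 0%N word c).
Definition rbot c := wpos (take c word) (nth 0%N word c).+1.

Definition root c (j : nat) : int := (j == rtop c)%:R - (j == rbot c)%:R.

Definition rpair c d : int := root d (rtop c) - root d (rbot c).

Lemma rtop_neq_rbot c : rtop c == rbot c = false.
Proof. by rewrite (inj_eq (@wpos_inj _)) ltn_eqF. Qed.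

Lemma rpair_sym c d : rpair c d = rpair d c.
Proof.
by rewrite /rpair /root !(eq_sym (rtop d)) !(eq_sym (rbot d)); ring.
Qed.

Lemma rpair_self c : rpair c c = 2.
Proof. by rewrite /rpair /root !eqxx [rbot c == _]eq_sym rtop_neq_rbot. Qed.

Lemma fundw_sw i x y : (0 < x)%N ->
  fundw i y - fundw i (sw x y) = if x == i then (y == x)%:R - (y == x.+1)%:R else 0.
Proof.
move=> x0; rewrite /fundw /sw; case: (eqVneq y x) => [->|yx].
  by case: (eqVneq x i) => xi; lia.
case: (eqVneq y x.+1) => [->|yx1]; first by case: (eqVneq x i) => xi; lia.
by rewrite !subrr; case: ifP.
Qed.

(** The reflection [s_i] subtracts [alpha_i] from the fundamental weight of [i] and the other
    reflections fix it, so each letter [i] contributes one root. *)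
Lemma fundw_telescope i m j : (m <= size word)%N ->
  fundw i j = fundw i (spos (take m word) j)
    + \sum_(0 <= c < m | nth 0%N word c == i) root c j.
Proof.
elim: m => [|m IH] hm; first by rewrite big_geq // addr0 take0.
have x0 : (0 < nth 0%N word m)%N by case/andP: (word_bd m hm).
have -> : spos (take m.+1 word) j = sw (nth 0%N word m) (spos (take m word) j).
  by rewrite (take_nth 0%N) // /spos foldl_rcons.
rewrite big_mkcond big_nat_recr // -big_mkcond (IH (ltnW hm)).
have := fundw_sw i _ (spos (take m word) j) x0.
have -> : (spos (take m word) j == nth 0%N word m) = (j == rtop m).
  by rewrite /rtop -(inj_eq (@wpos_inj (take m word))) wposK.
have -> : (spos (take m word) j == (nth 0%N word m).+1) = (j == rbot m).
  by rewrite /rbot -(inj_eq (@wpos_inj (take m word))) wposK.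
rewrite -/(root m j) => /eqP; rewrite subr_eq => /eqP ->.
by rewrite /= addrA addrAC [X in X + _]addrC.
Qed.

Lemma sum_root c (u : nat -> int) : (c < size word)%N ->
  \sum_(1 <= j < (2 * n).+1) root c j * u j = u (rtop c) - u (rbot c).
Proof.
move=> hc.
have one x : (0 < x <= 2 * n)%N ->
    \sum_(1 <= j < (2 * n).+1) (j == x)%:R * u j = u x.
  move=> hx; transitivity (\sum_(1 <= j < (2 * n).+1 | j == x) u j).
    rewrite [RHS]big_mkcond; apply: eq_bigr => j _.
    by case: eqP => _; rewrite ?mul1r ?mul0r.
  by rewrite big_nat1_eq ltnS hx.
have := word_bd c hc => bd.
rewrite -(one (rtop c)) ?wpos_bd -?(one (rbot c)) ?wpos_bd //; try lia.
by rewrite -sumrB; apply: eq_bigr => j _; rewrite mulrBl.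
Qed.

(** Pairs the telescope at [m = c] with [beta_c]; moving [w_{<c}] across the form leaves the pairing
    of a fundamental weight with a simple root. *)
Lemma fundw_rpair c i : (c < size word)%N ->
  fundw i (rtop c) - fundw i (rbot c) = (nth 0%N word c == i)%:R
    + \sum_(0 <= d < c | nth 0%N word d == i) rpair c d.
Proof.
move=> hc; have hc' := ltnW hc.
rewrite (fundw_telescope i c (rtop c) hc') (fundw_telescope i c (rbot c) hc').
rewrite {1}/rtop {2}/rbot !sposK.
rewrite opprD addrACA -sumrB; congr (_ + _).
have x0 : (0 < nth 0%N word c)%N by case/andP: (word_bd c hc).
have := fundw_sw i _ (nth 0%N word c) x0.
by rewrite /sw eqxx => ->; case: eqVneq => //; rewrite ltn_eqF ?subr0.
Qed.

(** The second factor of [lam] is twice a fundamental weight minus the roots [beta_d]. By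
    [fundw_rpair] the doubled weight reverses the sign of the terms [d < c] and cancels [d = c],
    which turns the symmetric pairing into the skew family [G]. *)
Lemma lam_pairing (G : nat -> nat -> int) s t :
  (forall c, (c < size word)%N -> G c c = 0) ->
  (forall c d, (c < d)%N -> (d < size word)%N -> G c d = rpair c d) ->
  (forall c d, (c < d)%N -> (d < size word)%N -> G d c = - rpair c d) ->
  (s < t)%N -> (t < size word)%N ->
  lam n word s t =
  - \sum_(0 <= c < s.+1 | nth 0%N word c == nth 0%N word s)
      \sum_(0 <= d < t.+1 | nth 0%N word d == nth 0%N word t) G c d.
Proof.
move=> Gcc Gcd Gdc st ht; rewrite /lam /wform.
set i := nth 0%N word s; set k := nth 0%N word t.
have L j : fundw i j - wact (take s.+1 word) (fundw i) j
    = \sum_(0 <= c < s.+1 | nth 0%N word c == i) root c j.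
  rewrite wactE {1}(fundw_telescope i s.+1 j) //; last by lia.
  by rewrite addrAC subrr add0r.
have R j : fundw k j + wact (take t.+1 word) (fundw k) j
    = 2 * fundw k j - \sum_(0 <= d < t.+1 | nth 0%N word d == k) root d j.
  have := fundw_telescope k t.+1 j ht; rewrite wactE; lia.
under eq_bigr => j _ do rewrite L R mulr_suml.
rewrite exchange_big /= -sumrN; rewrite big_nat_cond [RHS]big_nat_cond.
apply: eq_bigr => c /andP[/andP[_ cs] ci]; rewrite sum_root; last by lia.
rewrite opprD opprK addrACA -mulrBr fundw_rpair; last by lia.
have -> : \sum_(0 <= d < t.+1 | nth 0%N word d == k) G c d =
  \sum_(0 <= d < t.+1 | nth 0%N word d == k) rpair c d
  - 2 * ((nth 0%N word c == k)%:R + \sum_(0 <= d < c | nth 0%N word d == k) rpair c d).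
  rewrite (big_cat_nat (n := c)) //=; last by lia.
  rewrite [X in _ = X - _](big_cat_nat (n := c)) //=; last by lia.
  rewrite (big_ltn_cond (m := c)); last by lia.
  rewrite [X in _ = _ + X - _](big_ltn_cond (m := c)); last by lia.
  have -> : \sum_(c.+1 <= d < t.+1 | nth 0%N word d == k) G c d
     = \sum_(c.+1 <= d < t.+1 | nth 0%N word d == k) rpair c d.
    rewrite big_nat_cond [RHS]big_nat_cond; apply: eq_bigr => d hd.
    by apply: Gcd; lia.
  have -> : \sum_(0 <= d < c | nth 0%N word d == k) G c d
     = - \sum_(0 <= d < c | nth 0%N word d == k) rpair c d.
    rewrite -sumrN big_nat_cond [RHS]big_nat_cond; apply: eq_bigr => d hd.
    by rewrite Gdc 1?rpair_sym //; lia.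
  by rewrite Gcc ?rpair_self; [case: eqP => _ /=; ring | lia].
have -> : \sum_(0 <= d < t.+1 | nth 0%N word d == k) rpair c d
   = \sum_(0 <= d < t.+1 | nth 0%N word d == k) root d (rtop c)
     - \sum_(0 <= d < t.+1 | nth 0%N word d == k) root d (rbot c).
  by rewrite -sumrB.
ring.
Qed.
End RootPairing.

(** * Frontiers of the twisted set *)

Section Frontier.
Variables (n : nat) (xi : nat -> int) (flat : bool).
Hypothesis hn : (2 <= n)%N.
Hypothesis hxi : forall i, (0 < i)%N -> (i < 2 * n - 2)%N ->
  xi i.+1 = xi i + 1 \/ xi i.+1 = xi i - 1.
Local Notation h := (2 * n%:Z - 1 : int).

Lemma xi_lip i j : (0 < i)%N -> (i <= j)%N -> (j <= 2 * n - 2)%N ->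
  `|xi j - xi i| <= j%:Z - i%:Z.
Proof.
move=> i0; elim: j => [|j IH] ij hj; first by lia.
have [->|ij'] := eqVneq i j.+1; first by rewrite !subrr normr0.
by have := IH ltac:(lia) ltac:(lia); have := hxi j ltac:(lia) ltac:(lia); lia.
Qed.

Lemma xi_par i : (0 < i)%N -> (i <= 2 * n - 2)%N -> (2 %| xi i - xi 1%N - i%:Z + 1)%Z.
Proof.
elim: i => // i IH _ hi; have [->|i0] := posnP i; first by rewrite subrr.
by have := IH i0 ltac:(lia); have := hxi i i0 ltac:(lia); lia.
Qed.

(** Coordinates are doubled. In row [n] the element added by [flat] sits at the top or at the
    bottom, so the sign moves the row by one step; its length is [h] either way. *)
Definition rowtop (r : nat) : int :=
  if (r < n)%N then 2 * xi r
  else if r == n then 2 * Num.max (xi n.-1) (xi n) + (if flat then 1 else -1)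
  else 2 * xi r.-1.

Definition rowstep (r : nat) : int := if r == n then 2 else 4.

(* Row [r] consists of the values above [rowbot r], excluded: below it the periodic
   continuation of the diagram starts, where row [2 n - r] takes the place of row [r]. *)
Definition rowbot (r : nat) : int := rowtop (2 * n - r)%N - 2 * h.

Definition in_row (r : nat) (q : int) : bool :=
  [&& (0 < r < 2 * n)%N, rowbot r < q, q <= rowtop r
    & (rowstep r %| rowtop r - q)%Z].

Lemma rowbot_mod r : (0 < r < 2 * n)%N -> (rowstep r %| rowtop r - rowbot r)%Z.
Proof.
move=> hr; rewrite /rowstep /rowbot.
have [->|rn] := eqVneq r n.
  rewrite (_ : (2 * n - n = n)%N); last lia.
  by apply/dvdzP; exists h; ring.
rewrite /rowtop; case: (ltnP r n) => h1.
  rewrite ifF; last lia; rewrite ifF; last lia.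
  have := xi_par r ltac:(lia) ltac:(lia).
  by have := xi_par (2 * n - r).-1 ltac:(lia) ltac:(lia); lia.
rewrite (negbTE rn) ifT; last lia.
have := xi_par r.-1 ltac:(lia) ltac:(lia).
by have := xi_par (2 * n - r) ltac:(lia) ltac:(lia); lia.
Qed.

Variable w : seq (nat * int).
Hypothesis w_uniq : uniq w.
Hypothesis w_row : forall x, (x \in w) = in_row x.1 x.2.
Hypothesis w_sorted : sorted (fun x y : nat * int => y.2 <= x.2) w.
Local Notation word := [seq x.1 | x <- w].
Local Notation x0 := (0%N, 0 : int).

Lemma w_mono c d : (c <= d)%N -> (d < size w)%N -> (nth x0 w d).2 <= (nth x0 w c).2.
Proof.
move=> cd dw; apply: (@sorted_leq_nth _ (fun x y : nat * int => y.2 <= x.2)) => //.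
- by move=> y x z xy yz; apply: le_trans yz xy.
- exact: (leq_ltn_trans cd dw).
Qed.

(** The coordinate of the next crossing of row [r] after [k] letters, or [rowbot r] once the row is
    exhausted. *)
Definition front (k r : nat) : int :=
  rowtop r - rowstep r * (count_mem r (take k word))%:Z.

Lemma front0 r : front 0 r = rowtop r.
Proof. by rewrite /front take0 mulr0 subr0. Qed.

Lemma frontS k r : (k < size w)%N ->
  front k.+1 r = if r == (nth x0 w k).1 then front k r - rowstep r else front k r.
Proof.
move=> kw; rewrite /front (take_nth 0%N) ?size_map // -cats1 count_cat /= addn0.
rewrite (nth_map x0) // eq_sym; case: eqP => _; rewrite ?addn0 // addn1.
by rewrite intS; ring.
Qed.

Lemma front_mod k r : (rowstep r %| rowtop r - front k r)%Z.
Proof.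
by apply/dvdzP; exists (count_mem r (take k word))%:Z; rewrite /front; ring.
Qed.

Lemma rowstep_gt0 r : 0 < rowstep r.
Proof. by rewrite /rowstep; case: ifP. Qed.

Lemma front_le_top k r : front k r <= rowtop r.
Proof. by rewrite /front; have := rowstep_gt0 r; nia. Qed.

Lemma in_take_nth k x : x \in take k w ->
  exists2 j, (j < k)%N & (j < size w)%N /\ nth x0 w j = x.
Proof.
move/(nthP x0) => [j]; rewrite size_take_min leq_min => /andP [jk jw].
by rewrite nth_take // => <-; exists j.
Qed.

Lemma take_ge k x y : (k < size w)%N -> y = nth x0 w k -> x \in take k w -> y.2 <= x.2.
Proof.
by move=> kw -> /in_take_nth [j jk [jw <-]]; apply: w_mono => //; apply: ltnW.
Qed.

Lemma notin_take_le k x y : (k < size w)%N -> y = nth x0 w k ->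
  x \in w -> x \notin take k w -> x.2 <= y.2.
Proof.
move=> kw -> xw xt; have iw : (index x w < size w)%N by rewrite index_mem.
have <- := nth_index x0 xw.
apply: w_mono => //; rewrite leqNgt; apply: contra xt => ik.
have <- := nth_index x0 xw; rewrite -(nth_take x0 ik) mem_nth //.
by rewrite size_take_min leq_min ik.
Qed.

Lemma nth_notin_take k : (k < size w)%N -> nth x0 w k \notin take k w.
Proof.
move=> kw; apply/negP => /in_take_nth [j jk [jw /eqP]].
by rewrite nth_uniq // ltn_eqF.
Qed.

Lemma dvdz_ltW (s a b : int) : 0 < s -> (s %| a - b)%Z -> b < a -> b + s <= a.
Proof.
move=> s0 /dvdzP [q e] ba.
have q0 : 0 < q by rewrite -(pmulr_lgt0 _ s0) -e subr_gt0.
by nia.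
Qed.

(** A row is an arithmetic progression. As the listing decreases, its next letter is its largest
    unread element, which is the front; so counting letters tells which elements are read. *)
Lemma front_inv k : (k <= size w)%N ->
  (forall r, (0 < r < 2 * n)%N -> rowbot r <= front k r) /\
  (forall x, x \in w -> (x \in take k w) = (front k x.1 < x.2)).
Proof.
elim: k => [_|k IH kw].
  split=> [r hr|x]; last by rewrite w_row front0 take0 in_nil => /and4P[_ _ + _]; lia.
  rewrite front0 /rowbot; have [->|rn] := eqVneq r n.
    by rewrite (_ : (2 * n - n = n)%N); lia.
  rewrite /rowtop; case: (ltnP r n) => h1.
    rewrite ifF; last lia; rewrite ifF; last lia.
    by have := xi_lip r (2 * n - r).-1 ltac:(lia) ltac:(lia) ltac:(lia); lia.
  rewrite (negbTE rn) ifT; last lia.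
  by have := xi_lip (2 * n - r) r.-1 ltac:(lia) ltac:(lia) ltac:(lia); lia.
have {IH} [IHb IHt] := IH (ltnW kw).
case E : (nth x0 w k) => [r q].
have rqw : (r, q) \in w by rewrite -E mem_nth.
have := rqw; rewrite w_row => /and4P[hr qb qt qm].
have s0 := rowstep_gt0 r.
have Fq : front k r = q.
  have nt : (r, q) \notin take k w by rewrite -E nth_notin_take.
  have := IHt _ rqw; rewrite (negbTE nt) => /esym/negbT; rewrite -leNgt /= => qF.
  apply/eqP; rewrite eq_le qF andbT leNgt; apply/negP => qlt.
  have yw : (r, front k r) \in w.
    by rewrite w_row /in_row hr front_mod front_le_top (lt_trans qb).
  have yt : (r, front k r) \notin take k w by rewrite IHt // ltxx.
  by have := notin_take_le _ _ _ kw (esym E) yw yt; rewrite leNgt qlt.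
split=> [r' hr'|[r' q'] xw].
  rewrite frontS // E; case: eqP => [->|_]; last exact: IHb.
  rewrite Fq lerBrDr; apply: dvdz_ltW => //=.
  rewrite (_ : q - rowbot r = (rowtop r - rowbot r) - (rowtop r - q)); last ring.
  by apply: rpredB => //; apply: rowbot_mod.
rewrite (take_nth x0) // mem_rcons inE E IHt // frontS // E /= xpair_eqE.
case: eqP => [er|_] //=; subst r'; rewrite Fq.
have := xw; rewrite w_row => /and4P[/= _ _ _ q'm].
have [->|qq'] := eqVneq q' q; first by rewrite ltrBlDr ltrDl s0.
have dq : (rowstep r %| q - q')%Z.
  by rewrite (_ : q - q' = (rowtop r - q') - (rowtop r - q)); [apply: rpredB | ring].
have [lt|lt|eq] := ltgtP q q'.
- by rewrite /= ltrBlDr (lt_trans lt) // ltrDl.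
- by apply/esym/negbTE; rewrite -leNgt lerBrDr; apply: dvdz_ltW.
- by rewrite eq eqxx in qq'.
Qed.

Section Step.
Variables (k r : nat) (q : int).
Hypothesis kw : (k < size w)%N.
Hypothesis Ek : nth x0 w k = (r, q).

Lemma cur_in_row : in_row r q.
Proof. by rewrite -(w_row (r, q)) -Ek mem_nth. Qed.

Lemma front_cur : front k r = q.
Proof.
have [IHb IHt] := front_inv _ (ltnW kw); have [_ IHt'] := front_inv _ kw.
have rqw : (r, q) \in w by rewrite -Ek mem_nth.
have := IHt _ rqw; have := IHt' _ rqw.
rewrite -Ek (negbTE (nth_notin_take _ kw)) (take_nth x0) // mem_rcons inE eqxx /=.
rewrite Ek /= frontS // Ek eqxx => /esym lt1 /esym/negbT; rewrite -leNgt => le1.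
have := cur_in_row => /and4P[_ _ _ qm].
apply/eqP; rewrite eq_le le1 andbT leNgt; apply/negP => lt2.
have := dvdz_ltW _ (front k r) q (rowstep_gt0 r) _ lt2.
rewrite (_ : front k r - q = (rowtop r - q) - (rowtop r - front k r)); last by ring.
by move/(_ (rpredB qm (front_mod k r))); lia.
Qed.

(** The element one step above the front is already read, hence at least [q], unless the row has not
    begun. *)
Lemma front_ge r' : (0 < r' < 2 * n)%N ->
  q - rowstep r' <= front k r' \/ front k r' = rowtop r'.
Proof.
move=> hr'; have [IHb IHt] := front_inv _ (ltnW kw).
have s0 := rowstep_gt0 r'.
have := front_le_top k r'; rewrite le_eqVlt => /predU1P[->|lt]; [by right | left].
have le1 := dvdz_ltW _ _ _ s0 (front_mod k r') lt.
have yw : (r', front k r' + rowstep r') \in w.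
  rewrite w_row /in_row /= hr' le1 (le_lt_trans (IHb r' hr')) ?ltrDl //=.
  by rewrite opprD addrA rpredB ?front_mod // dvdzz.
have yt : (r', front k r' + rowstep r') \in take k w by rewrite IHt //= ltrDl.
by have := take_ge _ _ _ kw (esym Ek) yt; rewrite /= lerBlDr.
Qed.

(** The front is unread, hence at most [q], unless the row is exhausted. *)
Lemma front_le r' : (0 < r' < 2 * n)%N ->
  front k r' <= q \/ front k r' = rowbot r'.
Proof.
move=> hr'; have [IHb IHt] := front_inv _ (ltnW kw).
have := IHb r' hr'; rewrite le_eqVlt => /predU1P[->|lt]; [by right | left].
have yw : (r', front k r') \in w.
  by rewrite w_row /in_row /= hr' lt front_le_top front_mod.
have yt : (r', front k r') \notin take k w by rewrite IHt //= ltxx.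
exact: (notin_take_le _ _ _ kw (esym Ek) yw yt).
Qed.
End Step.
End Frontier.

(** * Wires *)

Section Wires.
Variable n : nat.
Hypothesis hn : (2 <= n)%N.
Local Notation h := (2 * n%:Z - 1 : int).

Definition arow (i : nat) : nat := if (i < n)%N then i else i.+1.

Lemma arow_bd i : (0 < i <= 2 * n - 2)%N -> (0 < arow i < 2 * n)%N.
Proof. by rewrite /arow; case: (ltnP i n); lia. Qed.

Lemma arow_neq i : arow i != n.
Proof. by rewrite /arow; case: (ltnP i n); lia. Qed.

Lemma arow_inj i j : (arow i == arow j) = (i == j).
Proof. by rewrite /arow; case: (ltnP i n) => hi; case: (ltnP j n) => hj; lia. Qed.

Lemma arow_ex r : (0 < r < 2 * n)%N -> r != n ->
  exists2 i, (0 < i <= 2 * n - 2)%N & r = arow i.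
Proof.
move=> hr rn; rewrite /arow; have [rn'|rn'] := ltnP r n.
  by exists r; rewrite ?rn' //; lia.
by exists r.-1; [lia | rewrite ifF; lia].
Qed.

(* Wires of the diagram of type [A_(2n-2)] carry integers modulo [4 h];
   the extra wire, involved in every crossing of row [n], is [None]. *)
Definition wire (F : nat -> int) (i : nat) : int :=
  if (i == 1)%N || (i < 2 * n - 1)%N && (F (arow i.-1) < F (arow i))
  then F (arow i) + 2 * i%:Z else F (arow i.-1) - 2 * i.-1%:Z.

(** True when the extra wire is at position [n + 1], false when it is at position [n]. *)
Definition side (F : nat -> int) : bool := (4 %| F n + 1 - F n.-1)%Z.

Definition lab (F : nat -> int) (x : nat) : option int :=
  if (x < n)%N then Some (wire F x)
  else if (n.+1 < x)%N then Some (wire F x.-1)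
  else if (x == n) == side F then Some (wire F n) else None.

Definition leqv (a b : option int) : bool :=
  match a, b with
  | Some x, Some y => (4 * h %| x - y)%Z
  | None, None => true
  | _, _ => false
  end.

Lemma leqv_refl a : leqv a a.
Proof. by case: a => //= x; rewrite subrr dvdz0. Qed.

Lemma leqv_sym a b : leqv a b = leqv b a.
Proof. by case: a b => [x|] [y|] //=; rewrite -dvdz_opp opprB. Qed.

Lemma leqv_trans b a c : leqv a b -> leqv b c -> leqv a c.
Proof.
case: a b c => [x|] [y|] [z|] //= xy yz.
by rewrite -(subrK y x) -addrA rpredD.
Qed.

Lemma leqv_congr a b c d : leqv a b -> leqv c d -> leqv a c = leqv b d.
Proof.
move=> ab cd; apply/idP/idP => H.
  by apply: leqv_trans cd; apply: leqv_trans H; rewrite leqv_sym.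
by apply: (leqv_trans b) => //; apply: (leqv_trans d) => //; rewrite leqv_sym.
Qed.

(** A label refers to the crossing that its wire meets next: as first strand in row [i], or as
    second strand in row [i - 1], whichever front is larger. Here the neighbouring fronts are lower,
    so both strands meet row [i] next. *)
Lemma wire_top (F : nat -> int) i (q : int) : (0 < i <= 2 * n - 2)%N -> F (arow i) = q ->
  (forall j, (0 < j <= 2 * n - 2)%N -> j = i.+1 \/ i = j.+1 -> F (arow j) = q - 2) ->
  wire F i = q + 2 * i%:Z /\ wire F i.+1 = q - 2 * i%:Z.
Proof.
move=> hi Fi Fj; rewrite /wire; split.
  have [e|i1] := eqVneq i 1%N; first by rewrite /= Fi.
  rewrite /= ifT ?Fi //; have := Fj i.-1; rewrite /=; lia.
rewrite /= ifF ?Fi //; case: (ltnP i.+1 (2 * n - 1)) => hi1; last by lia.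
by rewrite (Fj i.+1) ?Fi; lia.
Qed.

(** Each strand now heads for a neighbouring row, whose front [q - 2] gives back the label it had
    before. At position 1 it meets row 1 again, at [q - 4], with the same result. *)
Lemma wire_next (F F' : nat -> int) i (q : int) : (0 < i <= 2 * n - 2)%N ->
  F (arow i) = q ->
  (forall j, (0 < j <= 2 * n - 2)%N -> j = i.+1 \/ i = j.+1 -> F (arow j) = q - 2) ->
  F' (arow i) = q - 4 -> (forall j, j != i -> F' (arow j) = F (arow j)) ->
  leqv (Some (wire F' i)) (Some (wire F i.+1)) /\
  leqv (Some (wire F' i.+1)) (Some (wire F i)).
Proof.
move=> hi Fi Fj F'i F'j; have [-> ->] := wire_top F i q hi Fi Fj.
split; rewrite /wire /=.
  have [e|i1] := eqVneq i 1%N.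
    by rewrite F'i e (_ : _ - _ = 0) ?dvdz0 //=; lia.
  rewrite F'i F'j ?(Fj i.-1) ?ifF; try lia.
  by rewrite (_ : _ - _ = 0) ?dvdz0 //; lia.
have [hi1|hi1] := ltnP i.+1 (2 * n - 1).
  rewrite F'i F'j ?(Fj i.+1) ?ifT; try lia.
  by rewrite (_ : _ - _ = 0) ?dvdz0 //; lia.
rewrite F'i ifF; last lia.
(* At the last position the strand turns back into the same row and its label drops by [4 h]: this
   is the origin of the modulus. *)
by apply/dvdzP; exists (-1); lia.
Qed.

Lemma wire_same (F F' : nat -> int) i j : (0 < j)%N ->
  (forall l, l != i -> F' (arow l) = F (arow l)) ->
  j != i -> j != i.+1 -> wire F' j = wire F j.
Proof.
move=> j0 FF ji ji1; rewrite /wire !FF //.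
by apply/eqP => e; case/eqP: ji1; lia.
Qed.

Lemma wire_same_mid (F F' : nat -> int) j :
  (forall l, F' (arow l) = F (arow l)) -> wire F' j = wire F j.
Proof. by move=> FF; rewrite /wire !FF. Qed.
End Wires.

(** * Neighbouring fronts at a crossing *)

Section CrossingFronts.
Variables (n : nat) (xi : nat -> int) (flat : bool).
Hypothesis hn : (2 <= n)%N.
Hypothesis hxi : forall i, (0 < i)%N -> (i < 2 * n - 2)%N ->
  xi i.+1 = xi i + 1 \/ xi i.+1 = xi i - 1.
Local Notation h := (2 * n%:Z - 1 : int).
Local Notation arow := (arow n).

Lemma rowtop_arow i : rowtop n xi flat (arow i) = 2 * xi i.
Proof.
rewrite /rowtop /arow; have [hi|hi] := ltnP i n; first by rewrite hi.
by rewrite ifF ?ifF //; lia.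
Qed.

Lemma rowbot_arow i : (0 < i <= 2 * n - 2)%N ->
  rowbot n xi flat (arow i) = 2 * xi (2 * n - 1 - i)%N - 2 * h.
Proof.
move=> hi; rewrite /rowbot -(rowtop_arow (2 * n - 1 - i)%N).
congr (rowtop _ _ _ _ - _); rewrite /arow.
by have [h1|h1] := ltnP i n; have [h2|h2] := ltnP (2 * n - 1 - i) n; lia.
Qed.

Lemma rowstep_arow i : rowstep n (arow i) = 4.
Proof. by rewrite /rowstep (negbTE (arow_neq n hn i)). Qed.

Lemma xi_step i j : (0 < i <= 2 * n - 2)%N -> (0 < j <= 2 * n - 2)%N ->
  j = i.+1 \/ i = j.+1 -> xi j = xi i + 1 \/ xi j = xi i - 1.
Proof.
move=> hi hj [e|e]; first by have := hxi i; rewrite e; lia.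
by have := hxi j; rewrite e; lia.
Qed.

Lemma xi_stepC i j : (0 < i <= 2 * n - 2)%N -> (0 < j <= 2 * n - 2)%N ->
  j = i.+1 \/ i = j.+1 -> xi (2 * n - 1 - j)%N = xi (2 * n - 1 - i)%N + 1
    \/ xi (2 * n - 1 - j)%N = xi (2 * n - 1 - i)%N - 1.
Proof. by move=> hi hj ij; apply: xi_step; lia. Qed.

Lemma rowtop_mid :
  rowtop n xi flat n = 2 * Num.max (xi n.-1) (xi n) + (if flat then 1 else -1).
Proof. by rewrite /rowtop ltnn eqxx. Qed.

Lemma rowbot_mid : rowbot n xi flat n = rowtop n xi flat n - 2 * h.
Proof. by rewrite /rowbot (_ : (2 * n - n)%N = n) //; lia. Qed.

Lemma rowstep_mid : rowstep n n = 2.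
Proof. by rewrite /rowstep eqxx. Qed.

Lemma xi_mid : xi n = xi n.-1 + 1 \/ xi n = xi n.-1 - 1.
Proof. by apply: xi_step; lia. Qed.

Variable w : seq (nat * int).
Hypothesis w_uniq : uniq w.
Hypothesis w_row : forall x, (x \in w) = in_row n xi flat x.1 x.2.
Hypothesis w_sorted : sorted (fun x y : nat * int => y.2 <= x.2) w.
Local Notation word := [seq x.1 | x <- w].
Local Notation x0 := (0%N, 0 : int).
Local Notation front := (front n xi flat w).

Section Crossing.
Variables (k r : nat) (q : int).
Hypothesis kw : (k < size w)%N.
Hypothesis Ek : nth x0 w k = (r, q).

Let rq_row : in_row n xi flat r q.
Proof. exact: cur_in_row Ek. Qed.

(** This front is [q + 2] modulo 4 and lies between [q - 4] and [q]. For a row not begun or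
    exhausted, the missing bound holds because neighbouring heights differ by 1. *)
Lemma front_nbr i j : (0 < i <= 2 * n - 2)%N -> (0 < j <= 2 * n - 2)%N ->
  r = arow i -> j = i.+1 \/ i = j.+1 -> front k (arow j) = q - 2.
Proof.
move=> hi hj er ij; have bdj := arow_bd n hn j hj.
have := front_ge n xi flat hn hxi w w_uniq w_row w_sorted k r q kw Ek _ bdj.
have := front_le n xi flat hn hxi w w_uniq w_row w_sorted k r q kw Ek _ bdj.
have := front_mod n xi flat w k (arow j).
have := rq_row; rewrite /in_row er !rowstep_arow !rowtop_arow !rowbot_arow //.
move=> /and4P[_]; move: (front k (arow j)) => f.
have := xi_step _ _ hi hj ij; have := xi_stepC _ _ hi hj ij.
by move: (xi i) (xi j) (xi _) (xi _) => a b c d; lia.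
Qed.

(** Row [n] has odd coordinates and step 2, so the window from [q - 2] to [q] contains one
    candidate. *)
Lemma front_mid i : i = n.-1 \/ i = n -> r = arow i -> front k n = q - 1.
Proof.
move=> hi er; have bdn : (0 < n < 2 * n)%N by lia.
have bdi : (0 < i <= 2 * n - 2)%N by lia.
have := front_ge n xi flat hn hxi w w_uniq w_row w_sorted k r q kw Ek _ bdn.
have := front_le n xi flat hn hxi w w_uniq w_row w_sorted k r q kw Ek _ bdn.
have := front_mod n xi flat w k n; have := rq_row.
rewrite /in_row er rowbot_mid rowtop_mid rowstep_mid !rowstep_arow !rowtop_arow.
rewrite rowbot_arow // => /and4P[_]; move: (front k n) => f.
have := xi_mid; have [->|->] := hi.
  rewrite (_ : (2 * n - 1 - n.-1 = n)%N); last lia.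
  by move: (xi n) (xi n.-1) => a b; case: (flat); lia.
rewrite (_ : (2 * n - 1 - n = n.-1)%N); last lia.
by move: (xi n) (xi n.-1) => a b; case: (flat); lia.
Qed.

(** Rows [n - 1] and [n + 1] occupy opposite classes modulo 4; which of the two fronts is nearer
    tells the side of the extra wire. *)
Lemma front_sides : r = n ->
  (front k n.-1 = q - 1 /\ front k n.+1 = q - 3) \/
  (front k n.-1 = q - 3 /\ front k n.+1 = q - 1).
Proof.
move=> er.
have a1 : arow n.-1 = n.-1 by rewrite /arow ifT //; lia.
have a2 : arow n = n.+1 by rewrite /arow ltnn.
rewrite -a2 -{1 2}a1.
have bd1 := arow_bd n hn n.-1 ltac:(lia); have bd2 := arow_bd n hn n ltac:(lia).
have := front_ge n xi flat hn hxi w w_uniq w_row w_sorted k r q kw Ek _ bd1.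
have := front_le n xi flat hn hxi w w_uniq w_row w_sorted k r q kw Ek _ bd1.
have := front_ge n xi flat hn hxi w w_uniq w_row w_sorted k r q kw Ek _ bd2.
have := front_le n xi flat hn hxi w w_uniq w_row w_sorted k r q kw Ek _ bd2.
have := front_mod n xi flat w k (arow n.-1).
have := front_mod n xi flat w k (arow n); have := rq_row.
rewrite /in_row er rowbot_mid rowtop_mid rowstep_mid !rowstep_arow !rowtop_arow.
rewrite !rowbot_arow; [|lia..].
rewrite (_ : (2 * n - 1 - n.-1 = n)%N); last lia.
rewrite (_ : (2 * n - 1 - n = n.-1)%N); last lia.
move=> /and4P[_]; have := xi_mid.
move: (front k (arow n)) (front k (arow n.-1)) => f g.
by move: (xi n) (xi n.-1) => a b; case: (flat); lia.
Qed.
End Crossing.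

End CrossingFronts.

Ltac case_ifs := repeat (match goal with |- context [if ?b then _ else _] =>
  lazymatch b with context [if _ then _ else _] => fail | _ =>
  let H := fresh "H" in destruct b eqn:H end end; try (exfalso; lia)); rewrite //=.

(** * Labels are carried along the wires *)

Section Labels.
Variables (n : nat) (xi : nat -> int) (flat : bool).
Hypothesis hn : (2 <= n)%N.
Hypothesis hxi : forall i, (0 < i)%N -> (i < 2 * n - 2)%N ->
  xi i.+1 = xi i + 1 \/ xi i.+1 = xi i - 1.
Local Notation h := (2 * n%:Z - 1 : int).
Variable w : seq (nat * int).
Hypothesis w_uniq : uniq w.
Hypothesis w_row : forall x, (x \in w) = in_row n xi flat x.1 x.2.
Hypothesis w_sorted : sorted (fun x y : nat * int => y.2 <= x.2) w.
Local Notation word := [seq x.1 | x <- w].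
Local Notation x0 := (0%N, 0 : int).
Local Notation front := (front n xi flat w).
Local Notation arow := (arow n).
Local Notation wire := (wire n).
Local Notation side := (side n).
Local Notation lab := (lab n).
Local Notation leqv := (leqv n).

(** Position after deletion of the extra wire, which itself is sent to [None]. *)
Definition track (s : bool) (x : nat) : option nat :=
  if (x < n)%N then Some x else if (n.+1 < x)%N then Some x.-1
  else if (x == n) == s then Some n else None.

Lemma labE F x : lab F x = omap (wire F) (track (side F) x).
Proof. by rewrite /lab /track; do 3 case: ifP => //= _. Qed.

(** The conditions on [s] keep the extra wire away from the crossing, which therefore survives the
    deletion as a crossing of row [i]. *)
Lemma track_sw (s : bool) (i x : nat) : (0 < i <= 2 * n - 2)%N -> (i = n.-1 -> s) -> (i = n -> ~~ s) ->
  track s (sw (arow i) x) = omap (sw i) (track s x).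
Proof.
have side_true j y : (0 < j <= 2 * n - 2)%N -> j <> n ->
    track true (sw (arow j) y) = omap (sw j) (track true y).
  move=> hj nj; rewrite /track /sw /arow !eqb_id.
  by case_ifs; case_ifs; congr Some; lia.
have side_false j y : (0 < j <= 2 * n - 2)%N -> j <> n.-1 ->
    track false (sw (arow j) y) = omap (sw j) (track false y).
  move=> hj nj; rewrite /track /sw /arow !eqbF_neg.
  by case_ifs; case_ifs; congr Some; lia.
move=> hi; case: s => hs hs'; first by apply: side_true => // /hs'.
by apply: side_false => // /hs.
Qed.

Lemma frontS_eq k r q : (k < size w)%N -> nth x0 w k = (r, q) ->
  (front k.+1 r = q - rowstep n r) * (forall r', r' != r -> front k.+1 r' = front k r').
Proof.
move=> kw Ek; split=> [|r' /negbTE rr]; rewrite frontS // Ek /= ?rr //.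
by rewrite eqxx (front_cur n xi flat hn hxi w w_uniq w_row w_sorted k r q kw Ek).
Qed.

Lemma cur_bd k r q : (k < size w)%N -> nth x0 w k = (r, q) -> (0 < r < 2 * n)%N.
Proof. by move=> kw Ek; have := cur_in_row _ _ _ _ w_row _ _ _ kw Ek => /and4P[]. Qed.

Lemma side_arow k i q : (k < size w)%N -> nth x0 w k = (arow i, q) ->
  (0 < i <= 2 * n - 2)%N ->
  [/\ i = n.-1 -> side (front k), i = n -> ~~ side (front k)
    & side (front k.+1) = side (front k)].
Proof.
move=> kw Ek hi; have [_ Fne] := frontS_eq _ _ _ kw Ek.
have [Feq _] := frontS_eq _ _ _ kw Ek.
have Fcur := front_cur n xi flat hn hxi w w_uniq w_row w_sorted k _ q kw Ek.
have Fmid := front_mid n xi flat hn hxi w w_uniq w_row w_sorted k _ q kw Ek.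
have Fnbr := front_nbr n xi flat hn hxi w w_uniq w_row w_sorted k _ q kw Ek.
have a1 : arow n.-1 = n.-1 by rewrite /arow ifT //; lia.
have an : n != arow i by rewrite eq_sym (arow_neq n hn).
rewrite /side (Fne n) //; split.
- move=> ei; rewrite (Fmid i) //; last by left.
  by move: Fcur; rewrite ei a1 => ->; lia.
- move=> ei; rewrite (Fmid i) //; last by right.
  by rewrite -a1 (Fnbr i) //; lia.
have [ei|ei] := eqVneq (arow i) n.-1; last by rewrite Fne // eq_sym.
have ein : i = n.-1 by apply/eqP; rewrite -(arow_inj n hn) a1 ei.
by move: Fcur Feq; rewrite (Fmid i) //; [rewrite ei /rowstep ifF => [-> ->|]; lia | left].
Qed.

Lemma side_mid k q : (k < size w)%N -> nth x0 w k = (n, q) ->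
  side (front k.+1) = ~~ side (front k).
Proof.
move=> kw Ek; have [Feq Fne] := frontS_eq _ _ _ kw Ek.
have Fcur := front_cur n xi flat hn hxi w w_uniq w_row w_sorted k _ q kw Ek.
have := front_sides n xi flat hn hxi w w_uniq w_row w_sorted k _ q kw Ek erefl.
rewrite /side Fcur Feq Fne; last lia.
by rewrite rowstep_mid => -[[-> _]|[-> _]]; lia.
Qed.

(** In row [n] the labels of type A_{2n-2} stay and only [side] flips; in the other rows [side]
    stays and [wire_next] exchanges two labels. *)
Lemma lab_step k x : (k < size w)%N -> (0 < x)%N ->
  leqv (lab (front k.+1) x) (lab (front k) (sw (nth x0 w k).1 x)).
Proof.
move=> kw hx; case Ek : (nth x0 w k) => [r q] /=.
have hr := cur_bd _ _ _ kw Ek; have [Feq Fne] := frontS_eq _ _ _ kw Ek.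
have Fcur := front_cur n xi flat hn hxi w w_uniq w_row w_sorted k _ q kw Ek.
have [er|rn] := eqVneq r n.
  subst r; have FF j : wire (front k.+1) j = wire (front k) j.
    by apply: wire_same_mid => l; apply: Fne; apply: (arow_neq n hn).
  rewrite !labE (side_mid _ q) // /track /sw.
  case: (side _); rewrite /= ?eqb_id ?eqbF_neg; case_ifs;
    rewrite ?FF ?subrr ?dvdz0 //; lia.
have [i hi er] := arow_ex n hn r hr rn; subst r.
have [s1 s2 s3] := side_arow _ _ _ kw Ek hi.
rewrite !labE s3 track_sw //; case Et : (track _ x) => [t|] //=.
have t0 : (0 < t)%N by move: Et; rewrite /track; case_ifs => -[]; lia.
have FF l : l != i -> front k.+1 (arow l) = front k (arow l).
  by move=> li; apply: Fne; rewrite (arow_inj n hn).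
have Fnbr j hj := front_nbr n xi flat hn hxi w w_uniq w_row w_sorted k _ q kw Ek i j hi hj erefl.
have F4 : front k.+1 (arow i) = q - 4 by rewrite Feq (rowstep_arow n hn).
have [c1 c2] := wire_next n hn (front k) (front k.+1) i q hi Fcur Fnbr F4 FF.
rewrite /sw; case: (eqVneq t i) => [->|ti]; first exact: c1.
case: (eqVneq t i.+1) => [->|ti1]; first exact: c2.
by rewrite (wire_same n hn (front k) (front k.+1) i t) // subrr dvdz0.
Qed.

Lemma word_bd c : (c < size word)%N -> (0 < nth 0%N word c < 2 * n)%N.
Proof.
rewrite size_map => hc; rewrite (nth_map x0) //.
by case E : (nth x0 w c) => [r q]; apply: cur_bd E.
Qed.

Lemma lab_wpos k x : (k <= size w)%N -> (0 < x <= 2 * n)%N ->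
  leqv (lab (front k) x) (lab (front 0) (wpos (take k word) x)).
Proof.
elim: k x => [|k IH] x kw hx; first by rewrite take0 leqv_refl.
apply: leqv_trans (lab_step k x kw _) _; first by case/andP: hx.
rewrite (take_nth 0%N) ?size_map // /wpos foldr_rcons (nth_map x0) //.
apply: IH; first exact: ltnW.
have := word_bd k; rewrite size_map => /(_ kw); rewrite (nth_map x0) // /sw.
by case_ifs; lia.
Qed.

(** By the Lipschitz bound on [xi], half the difference of two initial labels is nonzero and less
    than [2 h] in absolute value. The four cases record which row each wire meets first. *)
Lemma wire_top_inj t t' : (0 < t <= 2 * n - 1)%N -> (0 < t' <= 2 * n - 1)%N ->
  (4 * h %| wire (rowtop n xi flat) t - wire (rowtop n xi flat) t')%Z -> t = t'.
Proof.
wlog tt : t t' / (t < t')%N => [W ht ht' d|ht ht'].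
  have [lt|lt|//] := ltngtP t t'; first exact: W.
  by apply/esym/W => //; rewrite -dvdz_opp opprB.
rewrite /wire !(rowtop_arow n xi flat hn) // => /dvdzP [m e]; exfalso.
suff : exists2 z : int, m * (4 * h) = 2 * z & (0 < z < 2 * h) || (- (2 * h) < z < 0).
  case=> z ez /orP[] hz.
    have [m0|m0] : m <= 0 \/ 1 <= m by lia.
      by nia.
    by nia.
  have [m0|m0] : 0 <= m \/ m <= -1 by lia.
    by nia.
  by nia.
rewrite -e {m e}; have L := xi_lip n xi hn hxi.
have [c1|c1] := boolP ((t == 1)%N || (t < 2 * n - 1)%N && (2 * xi t.-1 < 2 * xi t));
have [c2|c2] := boolP ((t' == 1)%N || (t' < 2 * n - 1)%N && (2 * xi t'.-1 < 2 * xi t')).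
- exists (xi t + t%:Z - (xi t' + t'%:Z)); first ring.
  have := L t t'.-1 ltac:(lia) ltac:(lia) ltac:(lia).
  by have := hxi t'.-1 ltac:(lia) ltac:(lia); rewrite prednK; lia.
- exists (xi t + t%:Z - (xi t'.-1 - t'.-1%:Z)); first ring.
  by have := L t t'.-1 ltac:(lia) ltac:(lia) ltac:(lia); lia.
- exists (xi t.-1 - t.-1%:Z - (xi t' + t'%:Z)); first ring.
  by have := L t.-1 t' ltac:(lia) ltac:(lia) ltac:(lia); lia.
- exists (xi t.-1 - t.-1%:Z - (xi t'.-1 - t'.-1%:Z)); first ring.
  have := L t t'.-1 ltac:(lia) ltac:(lia) ltac:(lia).
  by have := hxi t.-1 ltac:(lia) ltac:(lia); rewrite prednK; lia.
Qed.

Lemma lab0_inj x y : (0 < x <= 2 * n)%N -> (0 < y <= 2 * n)%N ->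
  leqv (lab (front 0) x) (lab (front 0) y) = (x == y).
Proof.
move=> hx hy; apply/idP/eqP => [|->]; last exact: leqv_refl.
have F0 j : wire (front 0) j = wire (rowtop n xi flat) j.
  by apply: wire_same_mid => l; rewrite front0.
rewrite !labE; move: (side _) => s.
have tb z t : (0 < z <= 2 * n)%N -> track s z = Some t -> (0 < t <= 2 * n - 1)%N.
  by rewrite /track; case_ifs => ? -[]; lia.
have tinj : track s x = track s y -> x = y.
  by rewrite /track; case: s {tb}; rewrite ?eqb_id ?eqbF_neg; case_ifs; try lia; case; lia.
case Ex : (track s x) tinj => [t|]; case Ey : (track s y) => [t'|] //= tinj; last by rewrite tinj.
rewrite !F0 => d; apply: tinj; congr Some.
by apply: wire_top_inj d; [apply: tb Ex | apply: tb Ey].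
Qed.

(** Carried back to the start of the diagram, a label determines its wire, so basis vectors can be
    compared through labels. *)
Lemma rpairE c d : (c < size w)%N -> (d < size w)%N ->
  rpair word c d =
  let L k e := lab (front k) ((nth x0 w k).1 + e)%N in
  (leqv (L c 0%N) (L d 0%N))%:R - (leqv (L c 0%N) (L d 1%N))%:R
  - (leqv (L c 1%N) (L d 0%N))%:R + (leqv (L c 1%N) (L d 1%N))%:R.
Proof.
move=> hc hd /=; rewrite /rpair /root /rtop /rbot !(nth_map x0) // !addn0 !addn1.
have bd k : (k < size w)%N -> (0 < (nth x0 w k).1 < 2 * n)%N.
  by move=> hk; have := word_bd k; rewrite size_map (nth_map x0) //; apply.
have := bd c hc; have := bd d hd.
move: (nth x0 w c).1 (nth x0 w d).1 => a b hb ha.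
have E x y : (0 < x <= 2 * n)%N -> (0 < y <= 2 * n)%N ->
    (wpos (take c word) x == wpos (take d word) y) = leqv (lab (front c) x) (lab (front d) y).
  move=> hx hy; rewrite -lab0_inj ?(wpos_bd n word word_bd) //.
  by apply/esym/leqv_congr; apply: lab_wpos => //; apply: ltnW.
by rewrite !E; try lia; ring.
Qed.
End Labels.

(** * Membership in the twisted set *)

Section TwistedSet.
Variables (n : nat) (xi : nat -> int) (flat : bool).
Hypothesis hn : (2 <= n)%N.
Hypothesis hxi : forall i, (0 < i)%N -> (i < 2 * n - 2)%N ->
  xi i.+1 = xi i + 1 \/ xi i.+1 = xi i - 1.
Local Notation h := (2 * n%:Z - 1 : int).

Lemma xi_cong i : (0 < i <= 2 * n - 2)%N -> (2 %| xi i - xi n.-1 - i%:Z + n.-1%:Z)%Z.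
Proof.
move=> /andP[i0 hi]; have := xi_par n xi hn hxi i i0 hi.
by have := xi_par n xi hn hxi n.-1 ltac:(lia) ltac:(lia); lia.
Qed.

Lemma mem_irange (lo hi x : int) : (x \in irange lo hi) = (lo < x <= hi).
Proof.
rewrite /irange; case: ltP => lohi; last by rewrite in_nil; lia.
apply/mapP/idP => [[k]|hx]; first by rewrite mem_iota => hk ->; lia.
by exists `|x - lo|.-1%N; [rewrite mem_iota; lia | lia].
Qed.

Lemma mem_Ihat i (p : int) : ((i, p) \in Ihat n xi) =
  [&& (0 < i <= 2 * n - 2)%N, xi (2 * n - 1 - i)%N - h < p, p <= xi i
    & (2 %| p - xi i)%Z].
Proof.
apply/allpairsPdep/idP => [[i' [p' [+ + [-> ->]]]]|/and4P[hi h1 h2 h3]].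
  by rewrite mem_iota mem_filter mem_irange => hi hp; apply/and4P; split; lia.
by exists i, p; rewrite mem_iota mem_filter mem_irange; split => //; lia.
Qed.

Lemma mem_Pnlist (p : int) : (p \in Pnlist n xi) =
  ((n.-1, p) \in Ihat n xi) || ((n, p) \in Ihat n xi).
Proof.
apply/mapP/orP => [[[i q]]|].
  by rewrite mem_filter /= => /andP[/orP[]/eqP -> hq ->]; [left | right].
case=> hp; [exists (n.-1, p) | exists (n, p)] => //;
  by rewrite mem_filter /= eqxx ?orbT hp.
Qed.

Lemma foldr_max_spec (x : int) s : foldr Num.max x s \in x :: s /\
  (forall y, y \in s -> y <= foldr Num.max x s).
Proof.
elim: s => [|z s [IH1 IH2]] /=; first by rewrite inE eqxx.
split=> [|y]; last by rewrite inE le_max => /predU1P[->|/IH2 ->]; rewrite ?lexx ?orbT.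
rewrite maxEle !inE; move: IH1; rewrite inE.
by case: ifP => _ /orP[] e; rewrite ?eqxx ?e ?orbT.
Qed.

Lemma foldr_min_spec (x : int) s : foldr Num.min x s \in x :: s /\
  (forall y, y \in s -> foldr Num.min x s <= y).
Proof.
elim: s => [|z s [IH1 IH2]] /=; first by rewrite inE eqxx.
split=> [|y]; last by rewrite inE ge_min => /predU1P[->|/IH2 ->]; rewrite ?lexx ?orbT.
rewrite minEle !inE; move: IH1; rewrite inE.
by case: ifP => _ /orP[] e; rewrite ?eqxx ?e ?orbT.
Qed.

Lemma mem_head_list (x z : int) s : z \in s -> x \in head 0 s :: s -> x \in s.
Proof. by case: s => //= a s _; rewrite !inE orbA orbb. Qed.

Lemma mem_Pn p : (p \in Pnlist n xi) =
  (xi n - h < p <= xi n.-1) && (2 %| p - xi n.-1)%Z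
  || (xi n.-1 - h < p <= xi n) && (2 %| p - xi n)%Z.
Proof.
rewrite mem_Pnlist !mem_Ihat.
rewrite (_ : (2 * n - 1 - n.-1 = n)%N); last lia.
rewrite (_ : (2 * n - 1 - n = n.-1)%N); last lia.
rewrite (_ : (0 < n.-1 <= 2 * n - 2)%N); last lia.
rewrite (_ : (0 < n <= 2 * n - 2)%N); last lia.
by rewrite /= !andbA.
Qed.

Lemma r_maxE : r_max n xi = Num.max (xi n.-1) (xi n).
Proof.
have [Hin Hub] := foldr_max_spec (head 0 (Pnlist n xi)) (Pnlist n xi).
have hm := xi_mid n xi hn hxi.
have p1 : xi n.-1 \in Pnlist n xi by rewrite mem_Pn; lia.
have p2 : xi n \in Pnlist n xi by rewrite mem_Pn; lia.
have := mem_head_list _ _ _ p1 Hin; rewrite -/(r_max n xi) mem_Pn.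
have := Hub _ p1; have := Hub _ p2; rewrite -/(r_max n xi).
move: (r_max n xi) (xi n) (xi n.-1) hm => a b c; lia.
Qed.

(** The two middle columns alternate and fill an interval of [h] integers; as [h] is odd, both ends
    lie in the column of larger height. *)
Lemma r_minE : r_min n xi = Num.max (xi n.-1) (xi n) - h + 1.
Proof.
have [Hin Hlb] := foldr_min_spec (head 0 (Pnlist n xi)) (Pnlist n xi).
have hm := xi_mid n xi hn hxi.
have p1 : Num.max (xi n.-1) (xi n) - h + 1 \in Pnlist n xi by rewrite mem_Pn; lia.
have := mem_head_list _ _ _ p1 Hin; rewrite -/(r_min n xi) mem_Pn.
have := Hlb _ p1; rewrite -/(r_min n xi).
move: (r_min n xi) (xi n) (xi n.-1) hm => a b c; lia.
Qed.

(** In row [n], the [h - 1] pairs of neighbours in the two middle columns and the element added by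
    [flat] form a progression of length [h]. The other rows are doubled columns of [Ihat]. *)
Lemma in_twistedE x : in_twisted n xi flat x = in_row n xi flat x.1 x.2.
Proof.
case: x => r q; rewrite /in_twisted /= r_maxE r_minE.
have [->|rn] := eqVneq r n.
  rewrite (_ : (0 < n <= n.-1)%N = false); last lia.
  rewrite ltnn !andFb !orFb !andTb.
  rewrite /in_row rowbot_mid // rowtop_mid rowstep_mid.
  rewrite (_ : (0 < n < 2 * n)%N); last lia.
  have [p [ep|ep]] : exists p : int, q = 2 * p \/ q = 2 * p - 1.
    by exists ((q + 1) %/ 2)%Z; lia.
    rewrite (_ : ((q %% 2)%Z == 1) = false) ?andFb ?orFb; last by rewrite ep; lia.
    rewrite ep; by move: (Num.max _ _) => m; case: (flat) => /=; lia.
  rewrite (_ : ((q %% 2)%Z == 1) = true) ?andTb; last by rewrite ep; lia.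
  rewrite (_ : ((q + 1) %/ 2)%Z = p); last by rewrite ep; lia.
  rewrite {}ep {q} !mem_Ihat.
  rewrite (_ : (2 * n - 1 - n.-1 = n)%N); last lia.
  rewrite (_ : (2 * n - 1 - n = n.-1)%N); last lia.
  rewrite (_ : (0 < n.-1 <= 2 * n - 2)%N); last lia.
  rewrite (_ : (0 < n <= 2 * n - 2)%N); last lia.
  have := xi_mid n xi hn hxi; move: (xi n) (xi n.-1) => a b.
  have : 2 <= n%:Z by lia.
  move: (n%:Z) => m; clear => m2.
  case=> ->; [rewrite (_ : Num.max b (b + 1) = b + 1) | rewrite (_ : Num.max b (b - 1) = b)];
    try lia; case: (flat) => /=; lia.
have [rlt|rgt|re] := ltngtP r n; last by rewrite re eqxx in rn.
  have er : r = arow n r by rewrite /arow rlt.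
  have [r0|r0] := posnP r; first by rewrite r0 /in_row /=; lia.
  have Et : rowtop n xi flat r = 2 * xi r by rewrite {1}er rowtop_arow.
  have Eb : rowbot n xi flat r = 2 * xi (2 * n - 1 - r)%N - 2 * h.
    by rewrite {1}er rowbot_arow //; lia.
  have Es : rowstep n r = 4 by rewrite er rowstep_arow.
  rewrite !andFb !orFb orbF mem_Ihat /in_row Et Eb Es.
  rewrite (_ : (r <= n.-1)%N) ?andTb; last lia.
  rewrite (_ : (0 < r <= 2 * n - 2)%N); last lia.
  rewrite (_ : (0 < r < 2 * n)%N); last lia.
  by move: (xi r) (xi _) => a b; clear; rewrite !andTb; lia.
have er : r = arow n r.-1 by rewrite /arow ifF; lia.
rewrite (_ : (0 < r <= n.-1)%N = false); last lia.
rewrite !andFb !orFb orbF andTb mem_Ihat /in_row.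
have [r2|r2] := leqP (2 * n) r.
  rewrite (_ : (0 < r.-1 <= 2 * n - 2)%N = false); last lia.
  by rewrite !andbF.
have Et : rowtop n xi flat r = 2 * xi r.-1 by rewrite {1}er rowtop_arow.
have Eb : rowbot n xi flat r = 2 * xi (2 * n - 1 - r.-1)%N - 2 * h.
  by rewrite {1}er rowbot_arow //; lia.
have Es : rowstep n r = 4 by rewrite er rowstep_arow.
rewrite Et Eb Es.
rewrite (_ : (0 < r.-1 <= 2 * n - 2)%N); last lia.
rewrite (_ : (0 < r)%N) ?andTb; last lia.
by move: (xi r.-1) (xi _) => a b; clear; rewrite ?andTb; lia.
Qed.
End TwistedSet.

(** * Folding the rows to type B *)

Section BIndex.
Variable n : nat.
Hypothesis hn : (2 <= n)%N.
Local Notation h := (2 * n%:Z - 1 : int).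
Local Notation E := (eper h).

Definition bidx (r : nat) : nat := if (r <= n)%N then r else (2 * n - r)%N.

Lemma bidx_bd r : (0 < r < 2 * n)%N -> (0 < bidx r <= n)%N.
Proof. by rewrite /bidx; case: ifP; lia. Qed.

Lemma bidx_arow i : (0 < i <= 2 * n - 2)%N ->
  exists2 b : bool, bidx (arow n i) = (if b then i else 2 * n - 1 - i)%N
    & (bidx (arow n i) < n)%N.
Proof.
move=> hi; have [b eb] : exists b, b = (i < n)%N by exists (i < n)%N.
exists b; rewrite /bidx /arow -eb; case: b eb => eb.
- by rewrite ifT; lia.
- by rewrite ifF; lia.
- by rewrite ifT; lia.
- by rewrite ifF; lia.
Qed.

(** Replacing [a] by [h - a] shifts arguments by multiples of [2 h], and the signs of [eper]
    compensate; so the index need not be folded. *)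
Lemma PB_arow i j (x : int) : (0 < i <= 2 * n - 2)%N -> (0 < j <= 2 * n - 2)%N ->
  PB n (bidx (arow n i)) (bidx (arow n j)) x =
  E (x + 2 * i%:Z - 2 * j%:Z) - E (x + 2 * i%:Z + 2 * j%:Z)
  - E (x - 2 * i%:Z - 2 * j%:Z) + E (x - 2 * i%:Z + 2 * j%:Z).
Proof.
move=> hi hj; have [b eb lb] := bidx_arow i hi; have [c ec lc] := bidx_arow j hj.
rewrite /PB lb lc eb ec.
have Q (a d : int) (a' d' : int) : a' = a \/ a' = h - a -> d' = d \/ d' = h - d ->
  E (x + 2 * a' - 2 * d') - E (x - 2 * a' - 2 * d') - E (x + 2 * a' + 2 * d')
  + E (x - 2 * a' + 2 * d') = E (x + 2 * a - 2 * d) - E (x + 2 * a + 2 * d)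
  - E (x - 2 * a - 2 * d) + E (x - 2 * a + 2 * d).
  case=> ->; case=> ->; first by ring.
  - rewrite (eper_eq _ (x + 2 * a - _) ((x + 2 * a + 2 * d) - 2 * h)); last ring.
    rewrite (eper_eq _ (x - 2 * a - 2 * (h - d)) ((x - 2 * a + 2 * d) - 2 * h)); last ring.
    rewrite (eper_eq _ (x + 2 * a + 2 * (h - d)) ((x + 2 * a - 2 * d) + 2 * h)); last ring.
    rewrite (eper_eq _ (x - 2 * a + 2 * (h - d)) ((x - 2 * a - 2 * d) + 2 * h)); last ring.
    by rewrite !(eper_half, eper_halfN); ring.
  - rewrite (eper_eq _ (x + 2 * (h - a) - _) ((x - 2 * a - 2 * d) + 2 * h)); last ring.
    rewrite (eper_eq _ (x - 2 * (h - a) - _) ((x + 2 * a - 2 * d) - 2 * h)); last ring.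
    rewrite (eper_eq _ (x + 2 * (h - a) + _) ((x - 2 * a + 2 * d) + 2 * h)); last ring.
    rewrite (eper_eq _ (x - 2 * (h - a) + _) ((x + 2 * a + 2 * d) - 2 * h)); last ring.
    by rewrite !(eper_half, eper_halfN); ring.
  - rewrite (eper_eq _ (x + 2 * (h - a) - 2 * (h - d)) (x - 2 * a + 2 * d)); last ring.
    rewrite (eper_eq _ (x - 2 * (h - a) - 2 * (h - d))
      ((x + 2 * a + 2 * d) - 2 * h - 2 * h)); last ring.
    rewrite (eper_eq _ (x + 2 * (h - a) + 2 * (h - d))
      ((x - 2 * a - 2 * d) + 2 * h + 2 * h)); last ring.
    rewrite (eper_eq _ (x - 2 * (h - a) + 2 * (h - d)) (x + 2 * a - 2 * d)); last ring.
    by rewrite !(eper_half, eper_halfN); ring.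
by apply: Q; [case: b {eb} | case: c {ec}]; lia.
Qed.

Lemma PB_arow_mid i (x : int) : (0 < i <= 2 * n - 2)%N ->
  PB n (bidx (arow n i)) n x = E (x + 2 * i%:Z - h) - E (x - 2 * i%:Z - h).
Proof.
move=> hi; have [b eb lb] := bidx_arow i hi; rewrite /PB lb ltnn eb {lb}.
case: b {eb} => //.
rewrite (eper_eq _ (x + 2 * (2 * n - 1 - i)%N%:Z - h)
  ((x - 2 * i%:Z - h) + 2 * h)); last lia.
rewrite (eper_eq _ (x - 2 * (2 * n - 1 - i)%N%:Z - h)
  ((x + 2 * i%:Z - h) - 2 * h)); last lia.
by rewrite eper_half eper_halfN; ring.
Qed.

(** As [h] is odd, a difference divisible by 4 never meets the negative values of [eper]. *)
Lemma leqv_eper (x y : int) : (4 %| x - y)%Z ->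
  (leqv n (Some x) (Some y))%:R = E (x - y) :> int.
Proof.
move=> d4; rewrite /eper /=; suff -> : (4 * h %| x - y - 2 * h)%Z = false by rewrite subr0.
by apply/negP => /dvdzP [q e]; move: d4 => /dvdzP [p ep]; nia.
Qed.
End BIndex.

(** * Root pairings as values of the commutation form *)

Section CrossingPairing.
Variables (n : nat) (xi : nat -> int) (flat : bool).
Hypothesis hn : (2 <= n)%N.
Hypothesis hxi : forall i, (0 < i)%N -> (i < 2 * n - 2)%N ->
  xi i.+1 = xi i + 1 \/ xi i.+1 = xi i - 1.
Local Notation h := (2 * n%:Z - 1 : int).
Variable w : seq (nat * int).
Hypothesis w_uniq : uniq w.
Hypothesis w_row : forall x, (x \in w) = in_row n xi flat x.1 x.2.
Hypothesis w_sorted : sorted (fun x y : nat * int => y.2 <= x.2) w.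
Local Notation word := [seq x.1 | x <- w].
Local Notation x0 := (0%N, 0 : int).
Local Notation front := (front n xi flat w).
Local Notation arow := (arow n).
Local Notation wire := (wire n).
Local Notation side := (side n).
Local Notation lab := (lab n).
Local Notation leqv := (leqv n).

Lemma track_arow (s : bool) (i : nat) : (0 < i <= 2 * n - 2)%N -> (i = n.-1 -> s) -> (i = n -> ~~ s) ->
  track n s (arow i) = Some i /\ track n s (arow i).+1 = Some i.+1.
Proof.
move=> hi h1 h2; case: s h1 h2 => h1 h2.
  have ni : i <> n by move/h2.
  by split; rewrite /track /arow !eqb_id; case_ifs; congr Some; lia.
have ni : i <> n.-1 by move/h1.
by split; rewrite /track /arow !eqbF_neg; case_ifs; congr Some; lia.
Qed.

Lemma cross_arow k i q : (k < size w)%N -> nth x0 w k = (arow i, q) ->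
  (0 < i <= 2 * n - 2)%N ->
  [/\ lab (front k) (arow i) = Some (q + 2 * i%:Z),
      lab (front k) (arow i).+1 = Some (q - 2 * i%:Z)
    & (4 %| 2 * xi i - q)%Z].
Proof.
move=> kw Ek hi.
have [s1 s2 _] := side_arow n xi flat hn hxi w w_uniq w_row w_sorted k i q kw Ek hi.
have [t1 t2] := track_arow _ _ hi s1 s2.
have Fcur := front_cur n xi flat hn hxi w w_uniq w_row w_sorted k _ q kw Ek.
have Fnbr j hj := front_nbr n xi flat hn hxi w w_uniq w_row w_sorted k _ q kw Ek i j hi hj erefl.
have [w1 w2] := wire_top n hn (front k) i q hi Fcur Fnbr.
rewrite !labE t1 t2 /= w1 w2; split=> //.
by have := front_mod n xi flat w k (arow i); rewrite Fcur rowtop_arow // rowstep_arow.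
Qed.

(** The congruence [s] expresses [side] through [q] alone, so that pairings depend on coordinates
    only. *)
Lemma cross_mid k q : (k < size w)%N -> nth x0 w k = (n, q) ->
  let s := (4 %| q + 1 - 2 * xi n.-1)%Z in
  [/\ lab (front k) n = (if s then Some (q + h) else None),
      lab (front k) n.+1 = (if s then None else Some (q - h))
    & (2 %| q + 1)%Z].
Proof.
move=> kw Ek /=.
have Fcur := front_cur n xi flat hn hxi w w_uniq w_row w_sorted k _ q kw Ek.
have Fsd := front_sides n xi flat hn hxi w w_uniq w_row w_sorted k _ q kw Ek erefl.
have a1 : arow n.-1 = n.-1 by rewrite /arow ifT //; lia.
have a2 : arow n = n.+1 by rewrite /arow ltnn.
have := front_mod n xi flat w k (arow n.-1); rewrite rowtop_arow // rowstep_arow // a1 => fm.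
have := front_mod n xi flat w k n; rewrite Fcur rowtop_mid rowstep_mid => fn.
have -> : (4 %| q + 1 - 2 * xi n.-1)%Z = side (front k).
  by rewrite /side Fcur; move: fm; move: (front k n.-1) (xi n.-1) => a b; lia.
have n1 : (n == 1)%N = false by lia.
have n2 : (n < 2 * n - 1)%N by lia.
have m1 : (n.+1 < n)%N = false by lia.
have m2 : (n.+1 == n) = false by lia.
have fn2 : (2 %| q + 1)%Z.
  by move: fn; case: (flat); move: (Num.max _ _) => a; lia.
rewrite /lab !ltnn m1 m2 eqxx.
case: Fsd => -[F1 F2].
  have -> : side (front k) = false by rewrite /side Fcur F1; lia.
  rewrite /= /wire n1 n2 a1 a2 F1 F2 ifF; last by lia.
  by split => //; congr Some; lia.
have -> : side (front k) = true by rewrite /side Fcur F1; lia.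
rewrite /= /wire n1 n2 a1 a2 F1 F2 ifT; last by lia.
by split => //; congr Some; lia.
Qed.

Lemma rpair_arow c d i j p q : (c < size w)%N -> (d < size w)%N ->
  nth x0 w c = (arow i, p) -> nth x0 w d = (arow j, q) ->
  (0 < i <= 2 * n - 2)%N -> (0 < j <= 2 * n - 2)%N ->
  rpair word c d = PB n (bidx n (arow i)) (bidx n (arow j)) (p - q).
Proof.
move=> hc hd Ec Ed hi hj; rewrite (rpairE n xi flat hn hxi w) //= Ec Ed /= !addn0 !addn1.
have [-> -> cp] := cross_arow _ _ _ hc Ec hi.
have [-> -> dq] := cross_arow _ _ _ hd Ed hj.
have ci := xi_cong n xi hn hxi i hi; have cj := xi_cong n xi hn hxi j hj.
rewrite !leqv_eper //; try lia.
rewrite PB_arow //.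
rewrite (eper_eq _ (p + 2 * i%:Z - (q + 2 * j%:Z)) (p - q + 2 * i%:Z - 2 * j%:Z)); last ring.
rewrite (eper_eq _ (p + 2 * i%:Z - (q - 2 * j%:Z)) (p - q + 2 * i%:Z + 2 * j%:Z)); last ring.
rewrite (eper_eq _ (p - 2 * i%:Z - (q + 2 * j%:Z)) (p - q - 2 * i%:Z - 2 * j%:Z)); last ring.
rewrite (eper_eq _ (p - 2 * i%:Z - (q - 2 * j%:Z)) (p - q - 2 * i%:Z + 2 * j%:Z)); last ring.
by [].
Qed.

Lemma rpair_arow_mid c d i p q : (c < size w)%N -> (d < size w)%N ->
  nth x0 w c = (arow i, p) -> nth x0 w d = (n, q) -> (0 < i <= 2 * n - 2)%N ->
  rpair word c d = PB n (bidx n (arow i)) n (p - q).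
Proof.
move=> hc hd Ec Ed hi; rewrite (rpairE n xi flat hn hxi w) //= Ec Ed /= !addn0 !addn1.
have [-> -> cp] := cross_arow _ _ _ hc Ec hi.
have [-> -> dq] := cross_mid _ _ hd Ed.
have ci := xi_cong n xi hn hxi i hi; rewrite PB_arow_mid //.
case: ifP => hs.
  rewrite !leqv_eper //; try lia.
  rewrite (eper_eq _ (p + 2 * i%:Z - (q + h)) (p - q + 2 * i%:Z - h)); last ring.
  rewrite (eper_eq _ (p - 2 * i%:Z - (q + h)) (p - q - 2 * i%:Z - h)); last ring.
  by rewrite /=; ring.
have hs' : (4 %| q - 1 - 2 * xi n.-1)%Z by lia.
rewrite !leqv_eper //; try lia.
rewrite (eper_eq _ (p + 2 * i%:Z - (q - h)) (p - q + 2 * i%:Z - h + 2 * h)); last ring.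
rewrite (eper_eq _ (p - 2 * i%:Z - (q - h)) (p - q - 2 * i%:Z - h + 2 * h)); last ring.
by rewrite !eper_half /=; ring.
Qed.

(** Both crossings involve the extra wire; it contributes 1 when it lies on the same side in both
    and -1 otherwise, which is [eper 1]. *)
Lemma rpair_mid c d p q : (c < size w)%N -> (d < size w)%N ->
  nth x0 w c = (n, p) -> nth x0 w d = (n, q) ->
  rpair word c d = PB n n n (p - q).
Proof.
move=> hc hd Ec Ed; rewrite (rpairE n xi flat hn hxi w) //= Ec Ed /= !addn0 !addn1.
have [-> -> cp] := cross_mid _ _ hc Ec.
have [-> -> dq] := cross_mid _ _ hd Ed.
rewrite /PB ltnn.
have e1 : eper 1 (p - q) = (4 %| p - q)%Z%:R - (4 %| p - q - 2)%Z%:R :> int.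
  by rewrite /eper !mulr1.
rewrite e1.
case: ifP => hs; case: ifP => ht.
- rewrite (leqv_eper n hn (p + h) (q + h)); last lia.
  rewrite (eper_eq _ (p + h - (q + h)) (p - q)); last ring.
  by rewrite /=; lia.
- rewrite (leqv_eper n hn (p + h) (q - h)); last lia.
  rewrite (eper_eq _ (p + h - (q - h)) (p - q + 2 * h)) ?eper_half; last ring.
  by rewrite /=; lia.
- rewrite (leqv_eper n hn (p - h) (q + h)); last lia.
  rewrite (eper_eq _ (p - h - (q + h)) (p - q - 2 * h)) ?eper_halfN; last ring.
  by rewrite /=; lia.
- rewrite (leqv_eper n hn (p - h) (q - h)); last lia.
  rewrite (eper_eq _ (p - h - (q - h)) (p - q)); last ring.
  by rewrite /=; lia.
Qed.

Lemma rpair_PB c d : (c < size w)%N -> (d < size w)%N ->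
  rpair word c d = PB n (bidx n (nth x0 w c).1) (bidx n (nth x0 w d).1)
    ((nth x0 w c).2 - (nth x0 w d).2).
Proof.
move=> hc hd; case Ec: (nth x0 w c) => [r p]; case Ed: (nth x0 w d) => [s q] /=.
have hr := cur_bd n xi flat w w_row _ _ _ hc Ec.
have hs := cur_bd n xi flat w w_row _ _ _ hd Ed.
have bn : bidx n n = n by rewrite /bidx leqnn.
have [er|rn] := eqVneq r n; have [es|sn] := eqVneq s n.
- by subst r s; rewrite bn; apply: rpair_mid.
- subst r; have [j hj ej] := arow_ex n hn s hs sn; subst s.
  rewrite rpair_sym bn (rpair_arow_mid d c j q p) // PB_sym // -PB_even opprB.
  by [].
- subst s; have [i hi ei] := arow_ex n hn r hr rn; subst r.
  by rewrite bn; apply: rpair_arow_mid.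
have [i hi ei] := arow_ex n hn r hr rn; have [j hj ej] := arow_ex n hn s hs sn.
by subst r s; apply: rpair_arow.
Qed.
End CrossingPairing.

(** * The isomorphism *)

Section Assembly.
Variables (n : nat) (xi : nat -> int) (flat : bool).
Hypothesis hn : (2 <= n)%N.
Hypothesis hxi : forall i, (0 < i)%N -> (i < 2 * n - 2)%N ->
  xi i.+1 = xi i + 1 \/ xi i.+1 = xi i - 1.
Local Notation h := (2 * n%:Z - 1 : int).
Variable w : seq (nat * int).
Hypothesis w_uniq : uniq w.
Hypothesis w_row : forall x, (x \in w) = in_row n xi flat x.1 x.2.
Hypothesis w_sorted : sorted (fun x y : nat * int => y.2 <= x.2) w.
Local Notation word := [seq x.1 | x <- w].
Local Notation x0 := (0%N, 0 : int).

Lemma ovlE x : ovl n x = (bidx n x.1, x.2).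
Proof. by case: x => r q; rewrite /ovl /bidx /=; case: ifP. Qed.

Lemma row_congr r q : in_row n xi flat r q -> r != n -> exists2 i,
  (0 < i <= 2 * n - 2)%N /\ r = arow n i & (4 %| 2 * xi i - q)%Z.
Proof.
move=> /and4P[hr _ _ hd] rn; have [i hi er] := arow_ex n hn r hr rn.
by exists i => //; move: hd; rewrite er rowtop_arow // rowstep_arow.
Qed.

Lemma bidx_eqn r : (0 < r < 2 * n)%N -> (bidx n r == n) = (r == n).
Proof. by rewrite /bidx; case: ifP; lia. Qed.

(** Rows [r] and [2 n - r] fold to the same index, but for [r != n] their coordinates differ by 2
    modulo 4. Hence [ovl] is injective on [w] and [kIr] counts within one row. *)
Lemma row_of_bidx x y : x \in w -> y \in w -> bidx n x.1 = bidx n y.1 ->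
  (rowstep n y.1 %| x.2 - y.2)%Z -> x.1 = y.1.
Proof.
case: x y => [r q] [r' q']; rewrite !w_row /= => hx hy e.
have hr : (0 < r < 2 * n)%N by case/and4P: hx.
have hr' : (0 < r' < 2 * n)%N by case/and4P: hy.
have [er'|rn'] := eqVneq r' n.
  by subst r' => _; apply/eqP; rewrite -(bidx_eqn r hr) e (bidx_eqn n hr').
have rn : r != n by rewrite -(bidx_eqn r hr) e (bidx_eqn r' hr').
have [i [hi ei] ci] := row_congr _ _ hx rn.
have [j [hj ej] cj] := row_congr _ _ hy rn'.
rewrite ej rowstep_arow // => d; rewrite ei.
have ki := xi_cong n xi hn hxi i hi; have kj := xi_cong n xi hn hxi j hj.
move: e; rewrite ei ej /bidx /arow.
move: ci cj ki kj; move: (xi i) (xi j) (xi n.-1) => a b c ci cj ki kj.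
have ij : (2 %| i%:Z - j%:Z)%Z by move: d ci cj ki kj; clear; lia.
move: ij hi hj hn; clear => ij hi hj hn.
by case: (ltnP i n) => h1; case: (ltnP j n) => h2; case: ifP => h3; case: ifP => h4; lia.
Qed.

Lemma ovl_inj : {in w &, injective (ovl n)}.
Proof.
move=> x y xw yw; rewrite !ovlE => -[e1 e2].
have := row_of_bidx x y xw yw e1; rewrite e2 subrr dvdz0 => /(_ isT).
by case: x y e2 {xw yw e1} => [a b] [c d] /= -> ->.
Qed.

Lemma uniq_ovl : uniq [seq ovl n x | x <- w].
Proof. by rewrite map_inj_in_uniq //; apply: ovl_inj. Qed.

Local Notation yv c := (ovl n (nth x0 w c)).

Lemma yv_inj c d : (c < size w)%N -> (d < size w)%N -> (yv c == yv d) = (c == d).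
Proof.
move=> hc hd; apply/eqP/eqP => [e|-> //].
have := ovl_inj _ _ (mem_nth x0 hc) (mem_nth x0 hd) e => /eqP.
by rewrite nth_uniq // => /eqP.
Qed.

Lemma yv_bd c : (c < size w)%N -> (0 < (yv c).1 <= n)%N.
Proof.
move=> hc; rewrite ovlE; apply: (bidx_bd n hn).
by have := mem_nth x0 hc; rewrite w_row => /and4P[].
Qed.

Definition gamw c d : int := gammaB n (yv c) (yv d).

Lemma gamw_skew c d : (c < size w)%N -> (d < size w)%N -> gamw c d = - gamw d c.
Proof. by move=> hc hd; apply: gammaB_skew => //; apply: yv_bd. Qed.

Lemma gamw_rpair c d : (c < d)%N -> (d < size w)%N -> gamw c d = rpair word c d.
Proof.
move=> cd hd; have hc := ltn_trans cd hd.
have ne : yv c != yv d by rewrite yv_inj // ltn_eqF.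
rewrite (rpair_PB n xi flat hn hxi w) // /gamw; move: ne (yv_bd c hc) (yv_bd d hd).
have := w_mono w w_sorted c d (ltnW cd) hd.
rewrite !ovlE => le ne h1 h2; exact: gammaB_PB.
Qed.

Definition mono_of (k : nat) : Yexp :=
  \sum_(0 <= c < k.+1 | nth 0%N word c == nth 0%N word k) << yv c >>.

Lemma BY_mono_of k l : BY n (mono_of k) (mono_of l) =
  \sum_(0 <= c < k.+1 | nth 0%N word c == nth 0%N word k)
     \sum_(0 <= d < l.+1 | nth 0%N word d == nth 0%N word l) gamw c d.
Proof.
rewrite /mono_of BY_suml; apply: eq_bigr => c _; rewrite BY_sumr.
by apply: eq_bigr => d _; rewrite BYU.
Qed.

Lemma BY_mono_of_skew k l : (k < size w)%N -> (l < size w)%N ->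
  BY n (mono_of k) (mono_of l) = - BY n (mono_of l) (mono_of k).
Proof.
move=> hk hl; rewrite !BY_mono_of [in RHS]exchange_big -sumrN /=.
rewrite big_nat_cond [RHS]big_nat_cond; apply: eq_bigr => c hc.
rewrite -sumrN big_nat_cond [RHS]big_nat_cond; apply: eq_bigr => d hd.
by apply: gamw_skew; lia.
Qed.

Lemma BY_mono_of_Lam k l : (k < size w)%N -> (l < size w)%N ->
  BY n (mono_of k) (mono_of l) = - Lam n word k l.
Proof.
move=> hk hl.
have lt s t : (s < t)%N -> (t < size w)%N ->
    BY n (mono_of s) (mono_of t) = - lam n word s t.
  move=> st ht; rewrite BY_mono_of (lam_pairing n word _ gamw) ?opprK ?size_map //.
  - by move=> c hc; apply: (word_bd n xi flat w w_row); rewrite size_map.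
  - by move=> c hc; rewrite /gamw gammaB_self //; apply: yv_bd.
  - by move=> c d cd hd; apply: gamw_rpair.
  - move=> c d cd hd; rewrite gamw_skew ?gamw_rpair //.
    exact: ltn_trans hd.
rewrite /Lam; case: (ltngtP k l) => [kl|lk|->]; first exact: lt.
  by rewrite BY_mono_of_skew // lt // opprK.
have := BY_mono_of_skew l l hl hl; lia.
Qed.

Lemma rowstep_bidx r : (0 < r < 2 * n)%N -> rowstep n r = 2 * rB n (bidx n r).
Proof.
move=> hr; rewrite /rowstep /rB; have e := bidx_eqn r hr.
have := bidx_bd n hn r hr; rewrite -e; case: eqP => [->|ne] hb; first by rewrite ltnn.
by rewrite ifT //; lia.
Qed.

(** A row is read from its top, so its positions up to [k] are exactly its coordinates from [q]
    upwards. *)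
Lemma mexp_mono_of k : (k < size w)%N ->
  mexp n (yv k).1 (kIr n [seq ovl n x | x <- w] (yv k).1 (yv k).2) (yv k).2 = mono_of k.
Proof.
move=> hk; case Ek : (nth x0 w k) => [r q]; rewrite ovlE /=; set i := bidx n r.
have rqw : (r, q) \in w by rewrite -Ek mem_nth.
have := rqw; rewrite w_row => /and4P[/= hr qb qt /dvdzP[z ez]].
have s0 := rowstep_gt0 n r; set st := rowstep n r in ez s0.
have est : 2 * rB n i = st by rewrite -rowstep_bidx.
have z0 : 0 <= z by rewrite -(pmulr_lge0 _ s0) -ez subr_ge0.
(* There are [z] steps from [q] to the top of the row, hence [z + 1] terms. *)
pose T : seq (nat * int) := [seq (i, q + st * s%:Z) | s <- iota 0 `|z|.+1].
pose A := [seq ovl n x | x <- w & (x.1 == r) && (q <= x.2)].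
have pTA : perm_eq T A.
  apply: uniq_perm.
  - rewrite map_inj_uniq ?iota_uniq // => s t [/addrI /(mulfI (lt0r_neq0 s0))].
    by case.
  - rewrite map_inj_in_uniq ?filter_uniq // => x y.
    by rewrite !mem_filter => /andP[_ xw] /andP[_ yw]; apply: ovl_inj.
  move=> y; apply/mapP/mapP => [[s]|[x]].
    rewrite mem_iota => /andP[_ hs] ->; exists (r, q + st * s%:Z); last by rewrite ovlE.
    rewrite mem_filter eqxx /= lerDl mulr_ge0 ?(ltW s0) //=.
    rewrite w_row /in_row hr /= -/st (lt_le_trans qb) ?lerDl ?mulr_ge0 ?(ltW s0) //=.
    apply/andP; split.
      rewrite -lerBrDl ez mulrC ler_wpM2r ?(ltW s0) //; lia.
    by apply/dvdzP; exists (z - s%:Z); rewrite opprD addrA ez; ring.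
  rewrite mem_filter => /andP[/andP[/eqP xr qx] xw] ->.
  have := xw; rewrite w_row xr => /and4P[/= _ _ xt /dvdzP[u eu]].
  have ex : x.2 - q = (z - u) * st.
    by rewrite mulrBl -ez -/st in eu *; rewrite -eu; ring.
  have zu : 0 <= z - u by rewrite -(pmulr_lge0 _ s0) -ex subr_ge0.
  have u0 : 0 <= u by rewrite -(pmulr_lge0 _ s0) -eu subr_ge0.
  exists `|z - u|%N; first by rewrite -[_ :: _]/(iota 0 `|z|.+1) mem_iota; lia.
  by rewrite ovlE xr -/i gez0_abs // mulrC -ex addrC subrK.
have eA : [seq y <- [seq ovl n x | x <- w] | (y.1 == i) && (q <= y.2)
    && (((y.2 - q) %% (2 * rB n i))%Z == 0)] = A.
  rewrite filter_map; congr map; apply: eq_in_filter => x xw /=.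
  rewrite ovlE /= est; apply/idP/idP => [/andP[/andP[/eqP e ->]] /eqP/dvdz_mod0P d|].
    by rewrite andbT; apply/eqP; apply: (row_of_bidx x (r, q)).
  move=> /andP[/eqP xr ->]; rewrite xr eqxx /=.
  have := xw; rewrite w_row xr => /and4P[_ _ _ d].
  apply/eqP/dvdz_mod0P.
  rewrite (_ : x.2 - q = (rowtop n xi flat r - q) - (rowtop n xi flat r - x.2)); last ring.
  by apply: rpredB => //; apply/dvdzP; exists z.
rewrite /kIr -size_filter eA -(perm_size pTA) size_map size_iota.
rewrite /mexp big_add1 /=.
transitivity (\sum_(y <- T) (<< y >> : Yexp)).
  by rewrite big_map /index_iota subn0; apply: eq_bigr => s _; rewrite est.
rewrite (perm_big _ pTA) big_map big_filter (big_nth x0).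
rewrite (big_cat_nat (n := k.+1)) //= [X in _ + X]big_nat_cond [X in _ + X]big_pred0.
  rewrite addr0 /mono_of big_nat_cond [RHS]big_nat_cond; apply: eq_bigl => c.
  apply/andb_id2l => /andP[_ ck].
  rewrite !(nth_map x0) ?Ek //; last exact: leq_trans hk.
  have := w_mono w w_sorted c k ck hk.
  by rewrite Ek /= => ->; rewrite andbT.
(* A later position of the row with coordinate at least [q] would repeat the element at [k]. *)
move=> c; apply/negP => /andP[/andP[kc cw] /andP[/eqP cr qc]].
have := w_mono w w_sorted k c (ltnW kc) cw; rewrite Ek /= => cq.
have : nth x0 w c == nth x0 w k.
  rewrite Ek; case: (nth x0 w c) cr qc cq => a b /= -> h1 h2.
  by rewrite xpair_eqE eqxx eq_le h1 h2.
by rewrite nth_uniq // gtn_eqF.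
Qed.

Definition phi (a : 'rV[int]_(size word)) : Yexp :=
  \sum_(k < size word) mono_of k *~ a 0 k.

Lemma phi_is_additive : zmod_morphism phi.
Proof.
by move=> a b; rewrite /phi -sumrB; apply: eq_bigr => k _; rewrite !mxE mulrzBr.
Qed.

HB.instance Definition _ := GRing.isZmodMorphism.Build _ _ phi phi_is_additive.

Lemma phi_delta k : phi (delta_mx 0 k) = mono_of k.
Proof.
rewrite /phi (bigD1 k) //= mxE !eqxx big1 ?addr0 // => j /negbTE jk.
by rewrite mxE jk andbF.
Qed.

Lemma ltn_word (k : 'I_(size word)) : (k < size w)%N.
Proof. by rewrite -(size_map (@fst nat int) w). Qed.

Lemma phi_BT u v : BY n (phi u) (phi v) = - BT n word u v.
Proof.
rewrite /BT /phi BY_suml -sumrN; apply: eq_bigr => k _.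
rewrite BY_sumr -sumrN; apply: eq_bigr => l _.
by rewrite BYMzl BYMzr BY_mono_of_Lam ?ltn_word //; ring.
Qed.

Lemma mcoeff_mono_of k c : (k < size w)%N -> (c < size w)%N ->
  (mono_of k)@_(yv c) =
  ((c <= k)%N && (nth 0%N word c == nth 0%N word k))%:R.
Proof.
move=> hk hc; rewrite /mono_of raddf_sum /=.
transitivity (\sum_(0 <= d < k.+1 | nth 0%N word d == nth 0%N word k) (d == c)%:R : int).
  rewrite big_nat_cond [RHS]big_nat_cond; apply: eq_bigr => d hd.
  by rewrite mcoeffU yv_inj //; lia.
rewrite big_mkcond; transitivity (\sum_(0 <= d < k.+1 | d == c)
    (nth 0%N word c == nth 0%N word k)%:R : int).
  rewrite [RHS]big_mkcond; apply: eq_bigr => d _.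
  by case: (eqVneq d c) => [->|_]; case: eqP.
by rewrite big_nat1_eq ltnS /=; case: leqP.
Qed.

(** [mono_of k] contains the generator at [k] once and otherwise only earlier ones, so coefficients
    vanish from the last index downwards. *)
Lemma phi_inj : injective phi.
Proof.
apply: raddf_inj => a a0.
suff H m (k : 'I_(size word)) : (size word - m <= k)%N -> a 0 k = 0.
  by apply/rowP => k; rewrite mxE; apply: (H (size word)); rewrite subnn.
elim: m k => [|m IH] k hk; first by have := ltn_ord k; lia.
have := congr1 (mcoeff (yv k)) a0; rewrite mcoeff0 /phi raddf_sum /= (bigD1 k) //= big1.
  by rewrite addr0 raddfMz /= mcoeff_mono_of ?ltn_word // leqnn eqxx intz.
move=> l lk; rewrite raddfMz /= mcoeff_mono_of ?ltn_word //.
have [kl|lk'] := leqP k l; last by rewrite mul0rz.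
rewrite (IH l) ?mulr0z //.
have : (k < l)%N by rewrite ltn_neqAle kl andbT eq_sym.
by lia.
Qed.

Lemma subspan_mono_of k : (k < size w)%N ->
  subspan n [seq ovl n x | x <- w] (mono_of k) /\
  subspan n [seq ovl n x | x <- w] (- mono_of k).
Proof.
move=> hk; rewrite /mono_of -sumrN big_nat_cond [X in _ /\ subspan _ _ X]big_nat_cond.
split; apply: subspan_sum => c hc; have hcw : (c < size w)%N by lia.
  by apply: subspan_gen; apply/map_f/mem_nth.
apply: subspan_geninv; first exact/map_f/mem_nth.
by apply: gammaB_self => //; apply: yv_bd.
Qed.

Lemma subspan_phi u : subspan n [seq ovl n x | x <- w] (phi u).
Proof.
apply: subspan_sum => k _; have [h1 h2] := subspan_mono_of k (ltn_word k).
exact: subspanMz.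
Qed.

(** Inverts the triangular system: a generator is [mono_of c] minus earlier generators of its
    row. *)
Lemma phi_onto a : a \in [seq ovl n x | x <- w] -> exists u, phi u = << a >>.
Proof.
case/mapP => x xw ->; rewrite -(nth_index x0 xw).
have : (index x w < size w)%N by rewrite index_mem.
move: (index x w) => {x xw}; elim/ltn_ind => c IH hc.
have hc' : (c < size word)%N by rewrite size_map.
have := phi_delta (Ordinal hc').
rewrite /= /mono_of big_mkcond big_nat_recr //= eqxx -big_mkcond /=.
have [v ->] : exists v,
    \sum_(0 <= d < c | nth 0%N word d == nth 0%N word c) << yv d >> = phi v.
  rewrite big_nat_cond; elim/big_ind: _ => [|y z [u ->] [v ->]|d hd].
  - by exists 0; rewrite raddf0.
  - by exists (u + v); rewrite raddfD.
  - have dc : (d < c)%N by lia.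
    by have [u eu] := IH d dc (ltn_trans dc hc); exists u; rewrite eu.
move=> e; exists (delta_mx 0 (Ordinal hc') - v).
by rewrite raddfB /= e addrAC subrr add0r.
Qed.
End Assembly.

Theorem theorem6p3 (n : nat) (hn : (2 <= n)%N)
  (orient : nat -> bool) (xi : nat -> int)
  (hxi : forall i, (1 <= i)%N -> (i < 2 * n - 2)%N ->
          xi i.+1 = xi i + (if orient i then 1 else -1))
  (flat : bool)
  (w : seq (nat * int))
  (hw_uniq : uniq w)
  (hw_mem : forall x, (x \in w) = in_twisted n xi flat x)
  (hw_sorted : sorted (fun x y : nat * int => y.2 <= x.2) w) :
  let word := [seq x.1 | x <- w] in
  let Ibar := undup [seq ovl n x | x <- w] in
  exists f : qtorus 'rV[int]_(size word) -> Yt n,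
    [/\ ((forall x y, f (x + y) = f x + f y) /\
         (forall x y, f (qmul (BT n word) x y) = Ymul n (f x) (f y)) /\
         f (qone _) = qone _),
        (f (qmono 1 0) = qmono (-1) 0 /\ f (qmono (-1) 0) = qmono 1 0),
        (forall k : 'I_(size word),
          let ir := ovl n (nth (0%N, 0) w k) in
          f (qmono 0 (delta_mx 0 k)) =
            underline n (mexp n ir.1 (kIr n Ibar ir.1 ir.2) ir.2)),
        (injective f /\ (forall y, in_gen_subalg n Ibar y <-> exists x, f x = y))
      & (forall x, f (qbar x) = Ybar n (f x))].
Proof.
have hxi' i : (0 < i)%N -> (i < 2 * n - 2)%N -> xi i.+1 = xi i + 1 \/ xi i.+1 = xi i - 1.
  by move=> i0 hi; rewrite hxi //; case: (orient i); [left | right].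
have w_row x : (x \in w) = in_row n xi flat x.1 x.2.
  by rewrite hw_mem; apply: in_twistedE.
move=> word Ibar.
have eI : Ibar = [seq ovl n x | x <- w].
  by apply: undup_id; apply: (uniq_ovl n xi flat hn hxi' w hw_uniq w_row hw_sorted).
pose ph : {additive 'rV[int]_(size word) -> Yexp} := phi n w.
have phB := phi_BT n xi flat hn hxi' w hw_uniq w_row hw_sorted.
exists (tmap _ _ ph); split.
- split; first by move=> x y; rewrite /tmap raddfD.
  split; first by move=> x y; apply: tmap_mul.
  by rewrite /qone tmap_mono oppr0 (raddf0 ph).
- by rewrite !tmap_mono (raddf0 ph) opprK.
- move=> k ir; rewrite tmap_mono oppr0 /= phi_delta eI.
  by rewrite (mexp_mono_of n xi flat hn hxi' w hw_uniq w_row hw_sorted) ?ltn_word.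
- split; first by apply: tmap_inj; apply: (phi_inj n xi flat hn hxi' w hw_uniq w_row hw_sorted).
  move=> y; rewrite eI; apply: (tmap_image _ (BT n word)) => //.
  + move=> a /mapP[x xw ->]; apply: gammaB_self => //.
    by rewrite -(nth_index (0%N, 0) xw); apply: (yv_bd n xi flat hn w w_row); rewrite index_mem.
  + exact: (subspan_phi n xi flat hn w hw_uniq w_row hw_sorted).
  + exact: (phi_onto n hn w hw_uniq hw_sorted).
by move=> x; apply: tmap_bar.
Qed.
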